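(* Let $G$ be a unimodular locally compact group and $(\pi,\mathcal H)$ a unitary representation of $G$. Suppose that $(\pi_1,\mathcal H_1)$ and $(\pi_2,\mathcal H_2)$ are two $L^2$ unitary representations of $G$ such that $(\pi,\mathcal H)\cong(\pi_1\otimes\pi_2,\ \mathcal H_1\hat\otimes\mathcal H_2)$. Let $u=\sum_{i=1}^n u_1^{(i)}\otimes u_2^{(i)}$, with $u_1^{(i)}\in\mathcal H_1$ and $u_2^{(i)}\in\mathcal H_2$, be such that the matrix coefficients with respect to $\{u_1^{(i)}\}$ and with respect to $\{u_2^{(i)}\}$ are all $L^2$, i.e. $g\mapsto(\pi_1(g)u_1^{(i)},u_1^{(j)})$ and $g\mapsto(\pi_2(g)u_2^{(i)},u_2^{(j)})$ are in $L^2(G)$ for all $i,j$. Then $$\int_G(\pi(g)u,u)\,dg=\sum_{i,j=1}^n\int_G(\pi_1(g)u_1^{(i)},u_1^{(j)})\,(\pi_2(g)u_2^{(i)},u_2^{(j)})\,dg\ \ge\ 0 .$$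
   Context: $dg$ is a fixed Haar measure on $G$. Unitary representations are strongly continuous. A unitary representation $(\sigma,\mathcal K)$ of $G$ is called $L^p$ if there is a cyclic vector $w\in\mathcal K$ such that $g\mapsto(\sigma(g)w,w)$ is in $L^p(G)$. $\mathcal H_1\hat\otimes\mathcal H_2$ is the Hilbert space (completed) tensor product, and $\mathcal H$ is identified with it via the given unitary equivalence, so that $u$ is regarded as a vector of $\mathcal H$. *)

(* Defs.v *)
From HB Require Import structures.
From mathcomp Require Import all_boot all_order all_algebra sesquilinear.
From mathcomp Require Import complex.
From mathcomp Require Import all_classical all_reals all_analysis.

Set Implicit Arguments.
Unset Strict Implicit.
Unset Printing Implicit Defensive.

Import Order.TTheory GRing.Theory Num.Theory.
Import numFieldNormedType.Exports.

Local Open Scope classical_set_scope.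
Local Open Scope ring_scope.

(** * Topological groups and Haar measures *)

HB.mixin Record isTopologicalGroup G & Topological G & Group G := {
  mulg_continuous : continuous (fun x : G * G => (x.1 * x.2)%g) ;
  invg_continuous : continuous (fun x : G => (x^-1)%g) }.

(* The base point is only there because measurable types are pointed in the
   library; a group is never empty, so this is no restriction. *)
#[short(type="topGroupType")]
HB.structure Definition TopologicalGroup :=
  {G of PointedTopological G & Group G & isTopologicalGroup G}.

(* "Locally compact group" includes the Hausdorff axiom. *)
Definition locally_compact_group (G : topGroupType) :=
  hausdorff_space G /\ locally_compact [set: G].

Notation borel G := (g_sigma_algebraType (@open G)).

Section haar.
Context (R : realType) (G : topGroupType).
Implicit Types mu : {measure set (borel G) -> \bar R}.

Definition radon_measure mu :=
  [/\ (forall K : set G, compact K -> (mu K < +oo)%E),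
      (forall A : set (borel G), measurable A ->
         mu A = ereal_inf [set mu V | V in [set V : set G | open V /\ A `<=` V]])
    & (forall V : set G, open V ->
         mu V = ereal_sup [set mu K | K in [set K : set G | compact K /\ K `<=` V]])].

Definition left_invariant mu := forall (g : G) (A : set (borel G)),
  measurable A -> mu [set (g * x)%g | x in (A : set G)] = mu A.

Definition right_invariant mu := forall (g : G) (A : set (borel G)),
  measurable A -> mu [set (x * g)%g | x in (A : set G)] = mu A.

Definition haar_measure mu :=
  [/\ radon_measure mu, left_invariant mu & mu [set: G] != 0%E].

Definition unimodular := forall mu, haar_measure mu -> right_invariant mu.

End haar.

Arguments unimodular : clear implicits.

(** * Complex-valued functions on a measure space *)

Section complex_integral.
Context d (T : measurableType d) (R : realType).
Variable mu : {measure set T -> \bar R}.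
Implicit Types f : T -> R[i].

Definition Cmeasurable f :=
  measurable_fun [set: T] (fun x => complex.Re (f x)) /\
  measurable_fun [set: T] (fun x => complex.Im (f x)).

Definition CLfun (p : \bar R) f :=
  Cmeasurable f /\ finite_norm mu p (fun x => complex.Re `|f x|).

Definition Cintegrable f :=
  mu.-integrable [set: T] (fun x => (complex.Re (f x))%:E) /\
  mu.-integrable [set: T] (fun x => (complex.Im (f x))%:E).

Definition Cintegral f : R[i] :=
  Complex (\int[mu]_x complex.Re (f x)) (\int[mu]_x complex.Im (f x)).

End complex_integral.

(** * Hilbert spaces *)

(* The inner product is linear in the first and antilinear in the second
   argument. *)
HB.mixin Record isHilbert (R : realType) H & CompleteNormedModule R[i] H := {
  hdot : {dot H for (@Num.conj R[i])} ;
  hdot_norm : forall x : H, `|x| ^+ 2 = hdot x x }.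

#[short(type="hilbertType")]
HB.structure Definition Hilbert (R : realType) :=
  {H of CompleteNormedModule R[i] H & isHilbert R H}.

Notation "''[' u , v ]" := (hdot u v) : ring_scope.

Definition linear_span (K : numDomainType) (V : lmodType K) (A : set V) : set V :=
  [set v | exists (n : nat) (a : 'I_n -> K) (e : 'I_n -> V),
     (forall i, A (e i)) /\ v = \sum_i a i *: e i].

(* [T], together with [tens], is the completion of the algebraic tensor product
   of [H1] and [H2] for the inner product (x ⊗ y, x' ⊗ y') = (x, x') (y, y').
   This determines ([T], [tens]) up to a unique unitary isomorphism. *)
Record hilbert_tensor (R : realType) (H1 H2 T : hilbertType R) := HilbertTensor {
  tens :> {bilinear H1 -> H2 -> T} ;
  tens_dot : forall x y x' y', '[tens x y, tens x' y'] = '[x, x'] * '[y, y'] ;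
  tens_dense : dense (linear_span [set tens xy.1 xy.2 | xy in [set: H1 * H2]]) }.

(** * Unitary representations *)

(* Each [rep g] is invertible by [rep_one] and [rep_mul], hence unitary. *)
Record unitary_rep (R : realType) (G : topGroupType) (H : hilbertType R) :=
  UnitaryRep {
    rep :> G -> {linear H -> H} ;
    rep_one : forall x, rep 1%g x = x ;
    rep_mul : forall g h x, rep (g * h)%g x = rep g (rep h x) ;
    rep_dot : forall g x y, '[rep g x, rep g y] = '[x, y] ;
    rep_continuous : forall x, continuous (fun g => rep g x) }.

Record unitary_equiv (R : realType) (G : topGroupType) (H K : hilbertType R)
    (pi : unitary_rep G H) (sigma : unitary_rep G K) := UnitaryEquiv {
  equiv :> {linear H -> K} ;
  equiv_dot : forall x y, '[equiv x, equiv y] = '[x, y] ;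
  equiv_surj : forall y, exists x, equiv x = y ;
  equiv_rep : forall g x, equiv (pi g x) = sigma g (equiv x) }.

(* By density of the span of the elementary tensors, at most one [rho] is the
   tensor product of [pi1] and [pi2]. *)
Definition is_tensor_rep (R : realType) (G : topGroupType)
    (H1 H2 T : hilbertType R) (t : hilbert_tensor H1 H2 T)
    (pi1 : unitary_rep G H1) (pi2 : unitary_rep G H2) (rho : unitary_rep G T) :=
  forall g x y, rho g (t x y) = t (pi1 g x) (pi2 g y).

Definition coef (R : realType) (G : topGroupType) (H : hilbertType R)
  (pi : unitary_rep G H) (x y : H) : borel G -> R[i] := fun g => '[pi g x, y].

Definition cyclic_vector (R : realType) (G : topGroupType) (H : hilbertType R)
    (pi : unitary_rep G H) (w : H) :=
  dense (linear_span [set pi g w | g in [set: G]]).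

Definition Lp_rep (R : realType) (G : topGroupType)
    (mu : {measure set (borel G) -> \bar R}) (p : \bar R)
    (H : hilbertType R) (pi : unitary_rep G H) :=
  exists w : H, cyclic_vector pi w /\ CLfun mu p (coef pi w w).

(* Main.v *)
Require Import Defs.
From HB Require Import structures.
From mathcomp Require Import all_boot all_order all_algebra sesquilinear.
From mathcomp Require Import complex zify ring lra.
From mathcomp Require Import all_classical all_reals all_analysis measurable_realfun.

Set Implicit Arguments.
Unset Strict Implicit.
Unset Printing Implicit Defensive.

Import Order.TTheory GRing.Theory Num.Theory.
Import numFieldNormedType.Exports.

Local Open Scope classical_set_scope.
Local Open Scope ring_scope.

(* For a representation [pi] with vectors [u_j], the vectors [v] for which all
   functions [g |-> (pi(g) v, u_j)] are square integrable form a [pi]-stable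
   domain with a closed form [q], hence a positive operator [h] commuting with
   [pi].  With [C = (h - 1) / (h + 1)] one has [1 - C^2 = 4 h (1 + h)^-2], so
     (v, w) = 4 \sum_(k < M) q ((1 + h)^-1 C^k v, (1 + h)^-1 C^k w) + (C^2M v, w),
   and [q (C^2M v, C^2M v)] tends to 0.  This replaces the square root of [h] in
   the embedding of [pi1] in L^2: up to a small error the coefficients of [pi1]
   become sums of [\int f_i(xg) f_j(x)^* dx] with [f_i] square integrable.
   Against the coefficients [(pi2(g) y_i, y_j)], where [y = (1 - C^2p) u2] is
   regular enough for weak integrals to exist, such a sum integrates to
   [|\sum_i \int f_i(g) pi2(g) y_i dg|^2].  Integrals are exchanged only as an
   inner product with a weak integral, so no Fubini theorem is needed.

   Both [g |-> (pi(g) v, u_j)] and [g |-> (v, pi(g) u_j)] have to be controlled.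
   Instead of proving that Haar measure is invariant under inversion, [q] is
   defined with a Haar measure and its image under inversion together. *)

Local Notation Re := (@complex.Re _).
Local Notation Im := (@complex.Im _).

(** * Complex numbers *)

Section complex_numbers.
Context (R : realType).
Implicit Types x y z : R[i].

Definition csq z : R := Re z ^+ 2 + Im z ^+ 2.

Lemma complex_eqP x y : Re x = Re y -> Im x = Im y -> x = y.
Proof. by case: x y => [a b] [c d] /= -> ->. Qed.

Lemma conj_conjc z : Num.conj z = conjc z.
Proof. by []. Qed.

Lemma cReD x y : Re (x + y) = Re x + Re y. Proof. by case: x y => [a b] []. Qed.
Lemma cImD x y : Im (x + y) = Im x + Im y. Proof. by case: x y => [a b] []. Qed.
Lemma cReN x : Re (- x) = - Re x. Proof. by case: x. Qed.
Lemma cImN x : Im (- x) = - Im x. Proof. by case: x. Qed.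
Lemma cReM x y : Re (x * y) = Re x * Re y - Im x * Im y.
Proof. by case: x y => [a b] []. Qed.
Lemma cImM x y : Im (x * y) = Re x * Im y + Im x * Re y.
Proof. by case: x y => [a b] []. Qed.
Lemma cReJ x : Re (Num.conj x) = Re x. Proof. by case: x. Qed.
Lemma cImJ x : Im (Num.conj x) = - Im x. Proof. by case: x. Qed.
Lemma cRe0 : Re (0 : R[i]) = 0. Proof. by []. Qed.
Lemma cIm0 : Im (0 : R[i]) = 0. Proof. by []. Qed.
Lemma cRe1 : Re (1 : R[i]) = 1. Proof. by []. Qed.
Lemma cIm1 : Im (1 : R[i]) = 0. Proof. by []. Qed.
Lemma cRe_nat n : Re (n%:R : R[i]) = n%:R.
Proof. by elim: n => // n IH; rewrite -addn1 !natrD cReD IH. Qed.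
Lemma cIm_nat n : Im (n%:R : R[i]) = 0.
Proof. by elim: n => // n IH; rewrite -addn1 !natrD cImD IH addr0. Qed.
Lemma cRe_sum I (r : seq I) (P : pred I) (F : I -> R[i]) :
  Re (\sum_(i <- r | P i) F i) = \sum_(i <- r | P i) Re (F i).
Proof. exact: (big_morph _ cReD cRe0). Qed.
Lemma cIm_sum I (r : seq I) (P : pred I) (F : I -> R[i]) :
  Im (\sum_(i <- r | P i) F i) = \sum_(i <- r | P i) Im (F i).
Proof. exact: (big_morph _ cImD cIm0). Qed.
Definition ReImE := (cReD, cImD, cReN, cImN, cReM, cImM, cReJ, cImJ, cRe_nat, cIm_nat,
  cRe_sum, cIm_sum, cRe0, cIm0, cRe1, cIm1).

Lemma complex_ge0 z : (0 <= z) = (Im z == 0) && (0 <= Re z).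
Proof. by rewrite lecE. Qed.

Lemma csq_ge0 z : 0 <= csq z.
Proof. by rewrite addr_ge0 ?sqr_ge0. Qed.

Lemma csqJ z : csq (Num.conj z) = csq z.
Proof. by rewrite /csq cReJ cImJ sqrrN. Qed.

Lemma csqM x y : csq (x * y) = csq x * csq y.
Proof. by rewrite /csq cReM cImM; ring. Qed.

Lemma norm_csq z : Re `|z| ^+ 2 = csq z.
Proof. by rewrite normc_def /= sqr_sqrtr ?csq_ge0. Qed.

Lemma Re_normc_ge0 z : 0 <= Re `|z|.
Proof. by rewrite normc_def /= sqrtr_ge0. Qed.

End complex_numbers.

Lemma discriminant_bound (R : realType) (a b x : R) :
  0 <= a -> 0 <= b -> (forall t : R, 0 <= a + 2 * t * x + t ^+ 2 * b) ->
  x ^+ 2 <= a * b.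
Proof.
move=> a0 b0 h.
have [b_eq0|b_neq0] := eqVneq b 0.
  have [->|x_neq0] := eqVneq x 0; first by rewrite expr0n mulr_ge0.
  (* For [b = 0] the quadratic is affine in [t], and this [t] gives it the value [-1]. *)
  have := h (- (a + 1) / (2 * x)).
  have -> : 2 * (- (a + 1) / (2 * x)) * x = - (a + 1) by field.
  by rewrite b_eq0; lra.
have b_gt0 : 0 < b by rewrite lt_neqAle eq_sym b_neq0.
have := h (- x / b).
have -> : a + 2 * (- x / b) * x + (- x / b) ^+ 2 * b = (a * b - x ^+ 2) / b by field.
by rewrite pmulr_lge0 ?invr_gt0// subr_ge0.
Qed.

(** * Semi-inner products on a subspace *)

Section semidot.
Context (R : realType) (V : lmodType R[i]).
Implicit Types (D : set V) (B : V -> V -> R[i]).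

(** The laws are required only on [D]: the forms to come are integrals, meaningful only where the
    integrands are integrable, so [B] is total but unconstrained off [D]. *)
Record semidot D B := Semidot {
  semidot_dom0 : D 0 ;
  semidot_domP : forall a u v, D u -> D v -> D (a *: u + v) ;
  semidotP : forall a u v w, D u -> D v -> D w -> B (a *: u + v) w = a * B u w + B v w ;
  semidotC : forall u v, D u -> D v -> B u v = Num.conj (B v u) ;
  semidot_ge0 : forall u, D u -> 0 <= Re (B u u) }.

Context (D : set V) (B : V -> V -> R[i]) (HB : semidot D B).

Lemma domD u v : D u -> D v -> D (u + v).
Proof. by move=> Du Dv; rewrite -[u]scale1r; exact: (semidot_domP HB). Qed.
Lemma domZ a u : D u -> D (a *: u).
Proof.
move=> Du; rewrite -[_ *: _]addr0; apply: (semidot_domP HB) => //.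
exact: (semidot_dom0 HB).
Qed.
Lemma domN u : D u -> D (- u).
Proof. by rewrite -scaleN1r; exact: domZ. Qed.
Lemma domB u v : D u -> D v -> D (u - v).
Proof. by move=> Du Dv; apply: domD => //; exact: domN. Qed.

Lemma semidotDl u v w : D u -> D v -> D w -> B (u + v) w = B u w + B v w.
Proof. by move=> Du Dv Dw; rewrite -[u in LHS]scale1r (semidotP HB)// mul1r. Qed.
Lemma semidot0l w : D w -> B 0 w = 0.
Proof.
move=> Dw; have := semidotDl (semidot_dom0 HB) (semidot_dom0 HB) Dw.
by rewrite addr0 => /eqP; rewrite addrC -subr_eq subrr eq_sym => /eqP.
Qed.
Lemma semidotZl a u w : D u -> D w -> B (a *: u) w = a * B u w.
Proof.
move=> Du Dw; rewrite -[_ *: _]addr0 (semidotP HB)// ?semidot0l ?addr0//.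
exact: (semidot_dom0 HB).
Qed.
Lemma semidotNl u w : D u -> D w -> B (- u) w = - B u w.
Proof. by move=> Du Dw; rewrite -scaleN1r semidotZl// mulN1r. Qed.
Lemma semidotBl u v w : D u -> D v -> D w -> B (u - v) w = B u w - B v w.
Proof. by move=> Du Dv Dw; rewrite semidotDl ?semidotNl//; exact: domN. Qed.
Lemma semidotDr u v w : D u -> D v -> D w -> B u (v + w) = B u v + B u w.
Proof.
move=> Du Dv Dw; rewrite (semidotC HB)//; last exact: domD.
by rewrite semidotDl// rmorphD/= -!(semidotC HB).
Qed.
Lemma semidotZr a u w : D u -> D w -> B u (a *: w) = Num.conj a * B u w.
Proof.
move=> Du Dw; rewrite (semidotC HB)//; last exact: domZ.
by rewrite semidotZl// rmorphM/= -(semidotC HB).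
Qed.
Lemma semidotNr u w : D u -> D w -> B u (- w) = - B u w.
Proof. by move=> Du Dw; rewrite -scaleN1r semidotZr// rmorphN rmorph1 mulN1r. Qed.
Lemma semidotBr u v w : D u -> D v -> D w -> B u (v - w) = B u v - B u w.
Proof. by move=> Du Dv Dw; rewrite semidotDr ?semidotNr//; exact: domN. Qed.
Lemma semidot0r w : D w -> B w 0 = 0.
Proof. by move=> Dw; rewrite (semidotC HB) ?semidot0l ?rmorph0//; exact: (semidot_dom0 HB). Qed.

Lemma semidot_Im0 u : D u -> Im (B u u) = 0.
Proof. by move=> Du; have := congr1 Im (semidotC HB Du Du); rewrite cImJ; lra. Qed.

Lemma semidot_real u : D u -> B u u = (Re (B u u))%:C%C.
Proof. by move=> Du; apply: complex_eqP => //=; exact: semidot_Im0. Qed.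

Lemma ReBC u v : D u -> D v -> Re (B u v) = Re (B v u).
Proof. by move=> Du Dv; rewrite (semidotC HB)// cReJ. Qed.

Lemma ReB_sqrD u v : D u -> D v ->
  Re (B (u + v) (u + v)) = Re (B u u) + 2 * Re (B u v) + Re (B v v).
Proof.
move=> Du Dv; have Duv := domD Du Dv.
rewrite semidotDl// !semidotDr// !cReD (ReBC Dv Du); ring.
Qed.

Lemma ReB_sqrZ (t : R) v : D v -> Re (B (t%:C%C *: v) (t%:C%C *: v)) = t ^+ 2 * Re (B v v).
Proof.
move=> Dv; rewrite semidotZl ?semidotZr//; last exact: domZ.
by rewrite !ReImE /=; ring.
Qed.

Lemma ReB_sqrDZ (t : R) u v : D u -> D v ->
  Re (B (u + t%:C%C *: v) (u + t%:C%C *: v)) =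
  Re (B u u) + 2 * t * Re (B u v) + t ^+ 2 * Re (B v v).
Proof.
move=> Du Dv; rewrite ReB_sqrD ?ReB_sqrZ//; last exact: domZ.
by rewrite semidotZr// !ReImE /=; ring.
Qed.

Lemma ReB_sqrB u v : D u -> D v ->
  Re (B (u - v) (u - v)) = Re (B u u) - 2 * Re (B u v) + Re (B v v).
Proof.
move=> Du Dv; rewrite ReB_sqrD ?semidotNr ?semidotNl//; do ?exact: domN.
by rewrite !cReN; ring.
Qed.

Lemma semidot_cauchy_Re u v : D u -> D v ->
  Re (B u v) ^+ 2 <= Re (B u u) * Re (B v v).
Proof.
move=> Du Dv; apply: discriminant_bound; do ?exact: (semidot_ge0 HB).
move=> t; rewrite -ReB_sqrDZ//; apply: (semidot_ge0 HB).
by apply: domD => //; exact: domZ.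
Qed.

(** The estimate for real parts, applied to [v] and to [i v], bounds the real and imaginary parts
    separately. The factor 2 that this costs is harmless, as the bound only serves continuity and
    smallness. *)
Lemma semidot_cauchy u v : D u -> D v ->
  csq (B u v) <= 2 * (Re (B u u) * Re (B v v)).
Proof.
move=> Du Dv; have h1 := semidot_cauchy_Re Du Dv.
have Div : D ('i%C *: v) by exact: domZ.
have := semidot_cauchy_Re Du Div.
have -> : Re (B u ('i%C *: v)) = Im (B u v).
  by rewrite semidotZr// !ReImE /=; ring.
have -> : Re (B ('i%C *: v) ('i%C *: v)) = Re (B v v).
  by rewrite semidotZl// semidotZr// !ReImE /=; ring.
by rewrite /csq; lra.
Qed.

(** By the parallelogram identity the two sides differ by the form at [u - v]. *)
Lemma ReB_sqrD_le u v : D u -> D v ->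
  Re (B (u + v) (u + v)) <= 2 * Re (B u u) + 2 * Re (B v v).
Proof.
move=> Du Dv; have := semidot_ge0 HB (domB Du Dv).
by rewrite ReB_sqrB// ReB_sqrD//; lra.
Qed.

End semidot.

Lemma semidot_sub (R : realType) (V : lmodType R[i]) (D D' : set V) B :
  D' 0 -> (forall a u v, D' u -> D' v -> D' (a *: u + v)) -> D' `<=` D ->
  semidot D B -> semidot D' B.
Proof.
move=> D'0 D'P sD HB; split => //.
- by move=> a u v w *; apply: (semidotP HB); exact: sD.
- by move=> u v *; apply: (semidotC HB); exact: sD.
- by move=> u *; apply: (semidot_ge0 HB); exact: sD.
Qed.

Lemma semidot_comp (R : realType) (V W : lmodType R[i]) (f : V -> W) D B :
  (forall a u v, f (a *: u + v) = a *: f u + f v) ->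
  semidot D B -> semidot (f @^-1` D) (fun u v => B (f u) (f v)).
Proof.
move=> fP HB.
have f0 : f 0 = 0 by rewrite -[0 in LHS](addr0 0) -[X in X + 0](scaler0 _ (-1)) fP scaleN1r addNr.
split.
- by rewrite /preimage /= f0; exact: (semidot_dom0 HB).
- by move=> a u v Du Dv; rewrite /preimage /= fP; exact: (semidot_domP HB).
- by move=> a u v w Du Dv Dw; rewrite fP; exact: (semidotP HB).
- by move=> u v Du Dv; exact: (semidotC HB).
- by move=> u Du; exact: (semidot_ge0 HB).
Qed.

Lemma semidot_sum (R : realType) (V : lmodType R[i]) (K : finType)
    (D : K -> set V) (B : K -> V -> V -> R[i]) :
  (forall k, semidot (D k) (B k)) ->
  semidot [set v | forall k, D k v] (fun u v => \sum_k B k u v).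
Proof.
move=> HB; split.
- by move=> k; exact: (semidot_dom0 (HB k)).
- by move=> a u v Du Dv k; exact: (semidot_domP (HB k)).
- move=> a u v w Du Dv Dw; rewrite mulr_sumr -big_split; apply: eq_bigr => k _.
  exact: (semidotP (HB k)).
- move=> u v Du Dv; rewrite rmorph_sum; apply: eq_bigr => k _.
  exact: (semidotC (HB k)).
- by move=> u Du; rewrite cRe_sum; apply: sumr_ge0 => k _; exact: (semidot_ge0 (HB k)).
Qed.

(** * Hilbert spaces *)

Section hilbert.
Context (R : realType) (H : hilbertType R).
Implicit Types u v w : H.

Definition hsq u : R := Re '[u, u].

Lemma semidot_hdot : semidot [set: H] (fun u v => '[u, v]).
Proof.
split => //.
- by move=> a u v w _ _ _; rewrite linearPl.
- by move=> u v _ _; rewrite (hermC (hdot : {dot H for Num.conj})) /= expr0 mul1r.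
- move=> u _; rewrite -hdot_norm.
  by have := exprn_ge0 2 (normr_ge0 u); rewrite complex_ge0 => /andP[_].
Qed.

Lemma hdotDl u v w : '[u + v, w] = '[u, w] + '[v, w].
Proof. exact: (semidotDl semidot_hdot). Qed.
Lemma hdotDr u v w : '[u, v + w] = '[u, v] + '[u, w].
Proof. exact: (semidotDr semidot_hdot). Qed.
Lemma hdotBl u v w : '[u - v, w] = '[u, w] - '[v, w].
Proof. exact: (semidotBl semidot_hdot). Qed.
Lemma hdotBr u v w : '[u, v - w] = '[u, v] - '[u, w].
Proof. exact: (semidotBr semidot_hdot). Qed.
Lemma hdotZl a u w : '[a *: u, w] = a * '[u, w].
Proof. exact: (semidotZl semidot_hdot). Qed.
Lemma hdotZr a u w : '[u, a *: w] = Num.conj a * '[u, w].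
Proof. exact: (semidotZr semidot_hdot). Qed.
Lemma hdotC u v : '[u, v] = Num.conj '[v, u].
Proof. exact: (semidotC semidot_hdot). Qed.
Lemma hsq_ge0 u : 0 <= hsq u.
Proof. exact: (semidot_ge0 semidot_hdot). Qed.
Lemma hdot_suml I (r : seq I) (P : pred I) (F : I -> H) w :
  '[\sum_(i <- r | P i) F i, w] = \sum_(i <- r | P i) '[F i, w].
Proof. by elim/big_rec2: _ => [|i x y _ <-]; rewrite ?hdotDl// (semidot0l semidot_hdot). Qed.
Lemma hdot_sumr I (r : seq I) (P : pred I) (F : I -> H) w :
  '[w, \sum_(i <- r | P i) F i] = \sum_(i <- r | P i) '[w, F i].
Proof. by elim/big_rec2: _ => [|i x y _ <-]; rewrite ?hdotDr// (semidot0r semidot_hdot). Qed.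

Lemma hdot_hsq u : '[u, u] = (hsq u)%:C%C.
Proof. exact: (semidot_real semidot_hdot). Qed.

Lemma hsq_eq0 u : hsq u = 0 -> u = 0.
Proof.
move=> u0; have : `|u| ^+ 2 = 0 by rewrite hdot_norm hdot_hsq u0.
by move=> /eqP; rewrite sqrf_eq0 normr_eq0 => /eqP.
Qed.

Lemma hnorm_hsq u : `|u| = (Num.sqrt (hsq u))%:C%C.
Proof.
apply/eqP; rewrite -(@eqrXn2 _ 2)//; last by rewrite ler0c sqrtr_ge0.
by rewrite hdot_norm hdot_hsq -rmorphXn /= sqr_sqrtr ?hsq_ge0.
Qed.

Lemma csq_hdot_le u v : csq '[u, v] <= 2 * (hsq u * hsq v).
Proof. exact: (semidot_cauchy semidot_hdot). Qed.

End hilbert.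

Lemma eq0_small (R : realType) (x c : R) :
  0 <= c -> 0 <= x -> (forall e, 0 < e -> x <= c * e) -> x = 0.
Proof.
move=> c0 x0 h; apply/eqP; rewrite eq_le x0 andbT leNgt; apply/negP => xgt0.
have c1 : 0 < 2 * (c + 1) by lra.
have := h (x / (2 * (c + 1))) (divr_gt0 xgt0 c1).
have : x / (2 * (c + 1)) > 0 by rewrite divr_gt0.
have : (2 * (c + 1)) * (x / (2 * (c + 1))) = x by field; rewrite gt_eqF//; lra.
set y := x / _; nra.
Qed.

Lemma vanishing_seq (R : realType) :
  exists2 d : nat -> R, forall n, 0 < d n &
    forall e, 0 < e -> exists N, forall n, (N <= n)%N -> d n < e.
Proof.
exists (fun n => n.+1%:R^-1) => [n|e e0]; first by rewrite invr_gt0.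
exists (Num.trunc e^-1) => n Nn; rewrite -[ltRHS]invrK ltf_pV2 ?posrE ?invr_gt0//.
by apply: (lt_le_trans (truncnS_gt _)); rewrite ler_nat.
Qed.

(** * Closed forms and resolvents *)

Section closed_forms.
Context (R : realType) (H : hilbertType R).

(** Closedness means that the domain is complete for the graph norm. It is stated with sequences and
    squared norms, so that the domain needs no normed space structure of its own. *)
Record closed_form := ClosedForm {
  fdom : set H ;
  form_val :> H -> H -> R[i] ;
  form_semidot : semidot fdom form_val ;
  form_complete : forall s : nat -> H, (forall n, fdom (s n)) ->
    (forall e : R, 0 < e -> exists N, forall i j, (N <= i)%N -> (N <= j)%N ->
      hsq (s i - s j) + Re (form_val (s i - s j) (s i - s j)) < e) ->
    exists2 z, fdom z & forall e : R, 0 < e -> exists N, forall i, (N <= i)%N ->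
      hsq (s i - z) + Re (form_val (s i - z) (s i - z)) < e }.

Variable q : closed_form.
Let D := fdom q.
Let qP := form_semidot q.

(** The graph inner product, formally [((1 + h) u, v)]. *)
Definition gdot (u v : H) : R[i] := '[u, v] + q u v.
Definition gsq (u : H) : R := Re (gdot u u).

Lemma semidot_gdot : semidot (fdom q) gdot.
Proof.
have hP := semidot_hdot H; split.
- exact: (semidot_dom0 qP).
- exact: (semidot_domP qP).
- by move=> a u v w Du Dv Dw; rewrite /gdot (semidotP hP)// (semidotP qP)//; ring.
- by move=> u v Du Dv; rewrite /gdot rmorphD/= -(semidotC hP)// -(semidotC qP).
- by move=> u Du; rewrite cReD addr_ge0 ?(semidot_ge0 hP)// (semidot_ge0 qP).
Qed.
Let gP := semidot_gdot.

Lemma gsqE u : gsq u = hsq u + Re (q u u).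
Proof. by rewrite /gsq /gdot cReD. Qed.

Lemma hsq_le_gsq u : fdom q u -> hsq u <= gsq u.
Proof. by move=> Du; rewrite gsqE lerDl (semidot_ge0 qP). Qed.

Lemma form_le_gsq u : Re (q u u) <= gsq u.
Proof. by rewrite gsqE lerDr hsq_ge0. Qed.

Lemma gdot_eq0 u : fdom q u -> gsq u = 0 -> u = 0.
Proof.
move=> Du u0; apply: hsq_eq0; apply/eqP; rewrite eq_le hsq_ge0 andbT -u0.
exact: hsq_le_gsq.
Qed.

Lemma gdot_sep u : fdom q u -> (forall w, fdom q w -> gdot u w = 0) -> u = 0.
Proof. by move=> Du h; apply: gdot_eq0 => //; rewrite /gsq h. Qed.

(** Riesz representation for the graph inner product, by minimizing [J w = gsq w - 2 Re (l w)]: a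
    minimizing sequence is Cauchy, and the vanishing of the first variation at its limit is the
    desired identity. *)
Lemma riesz (l : H -> R[i]) (c : R) : 0 <= c ->
  (forall a u v, fdom q u -> fdom q v -> l (a *: u + v) = Num.conj a * l u + l v) ->
  (forall w, fdom q w -> Re (l w) ^+ 2 <= c * gsq w) ->
  exists2 z, fdom q z & forall w, fdom q w -> gdot z w = l w.
Proof.
move=> c0 lP lb.
have D0 : D 0 := semidot_dom0 gP.
have lD u v : D u -> D v -> l (u + v) = l u + l v.
  by move=> Du Dv; rewrite -[u in LHS]scale1r lP// rmorph1 mul1r.
have l0 : l 0 = 0.
  by have /eqP := lD _ _ D0 D0; rewrite addr0 addrC -subr_eq subrr eq_sym => /eqP.
have lZ a u : D u -> l (a *: u) = Num.conj a * l u.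
  by move=> Du; rewrite -[_ *: _]addr0 lP// l0 addr0.
have gsq0 w : D w -> 0 <= gsq w by exact: (semidot_ge0 gP).
pose J w : R := gsq w - 2 * Re (l w).
have JlbE w : D w -> - c <= J w.
  (* If [J w < - c] then [gsq w + c < 2 Re (l w)]; squaring contradicts
     [4 c gsq w <= (gsq w + c)^2]. *)
  move=> Dw; have h1 := lb _ Dw; have h2 := gsq0 _ Dw; rewrite /J leNgt; apply/negP => h3.
  have h4 := sqr_ge0 (gsq w - c).
  have : (gsq w + c) ^+ 2 < (2 * Re (l w)) ^+ 2 by apply: ltrXn2r => //; [exact: addr_ge0|lra].
  by nra.
pose S := [set J w | w in D].
have hinf : has_inf S.
  split; first by exists (J 0), 0.
  by exists (- c) => _ [w Dw <-]; exact: JlbE.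
pose m := inf S.
have mJ w : D w -> m <= J w by move=> Dw; apply: ge_inf; [exact: hinf.2|exists w].
have [d d0 d_small] := vanishing_seq R.
have /choice[s sP] n : exists w, D w /\ J w < m + d n.
  have [_ [w Dw <-] Jw] := inf_adherent (d0 n) hinf.
  by exists w.
have JDZ (t : R) u v : D u -> D v ->
    J (u + t%:C%C *: v) = J u + 2 * t * Re (gdot u v - l v) + t ^+ 2 * gsq v.
  move=> Du Dv; have Dtv : D (t%:C%C *: v) by exact: (domZ gP).
  rewrite /J /gsq (ReB_sqrDZ gP)// lD// lZ// !ReImE /=; ring.
(* Parallelogram identity for [J], whose value at the midpoint of [u] and [v] is at least [m]. *)
have mid u v : D u -> D v -> gsq (u - v) <= 2 * J u + 2 * J v - 4 * m.
  move=> Du Dv.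
  have Dw : D (2^-1%:C%C *: (u + v)) by apply: (domZ gP); exact: (domD gP).
  have := mJ _ Dw; rewrite -[_ *: _]add0r JDZ//; last exact: (domD gP).
  rewrite {1}/J /gsq (ReB_sqrD gP)// (ReB_sqrB gP)// !(semidot0l gP)//.
    rewrite l0 lD// /J /gsq !ReImE; lra.
  exact: (domD gP).
have sC (e : R) : 0 < e -> exists N, forall i j, (N <= i)%N -> (N <= j)%N ->
      hsq (s i - s j) + Re (form_val q (s i - s j) (s i - s j)) < e.
  move=> e0; have [N NP] := d_small (e / 4) ltac:(lra).
  exists N => i j Ni Nj; rewrite -gsqE.
  have := mid _ _ (sP i).1 (sP j).1; have := (sP i).2; have := (sP j).2.
  by have := NP _ Ni; have := NP _ Nj; lra.
have [z Dz zP] := form_complete (fun n => (sP n).1) sC.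
have Re0E w : D w -> Re (gdot z w - l w) = 0.
  move=> Dw; apply/eqP; rewrite -sqrf_eq0; apply/eqP.
  have c4 : 0 <= 4 * gsq w by rewrite mulr_ge0 ?gsq0.
  apply: (eq0_small c4 (sqr_ge0 _)) => e e0.
  have [N NP] := zP _ e0.
  have [M MP] := d_small _ e0.
  pose n := maxn N M.
  have := NP n (leq_maxl _ _); rewrite -gsqE => sz.
  have ne := MP n (leq_maxr _ _).
  have Ds := (sP n).1.
  (* Since [J (s n + t w) >= m > J (s n) - d n] for every real [t], the discriminant of the
     quadratic in [t] bounds the first variation. *)
  have h1 : Re (gdot (s n) w - l w) ^+ 2 <= d n * gsq w.
    apply: discriminant_bound; [exact: ltW|exact: gsq0|move=> t].
    have := mJ _ (domD gP Ds (domZ gP t%:C%C Dw)); rewrite JDZ//.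
    by have := (sP n).2; lra.
  have h2 := semidot_cauchy_Re gP (domB gP Ds Dz) Dw.
  rewrite (semidotBl gP)// -/(gsq _) -/(gsq _) in h2.
  have gw := gsq0 _ Dw.
  have h3 : d n * gsq w <= e * gsq w by apply: ler_wpM2r => //; exact: ltW.
  have h4 : gsq (s n - z) * gsq w <= e * gsq w by apply: ler_wpM2r => //; exact: ltW.
  move: h1 h2; rewrite [Re (gdot z w - _)]cReD [Re (_ - l w)]cReD [Re (_ - gdot _ _)]cReD !cReN.
  move: (Re (gdot (s n) w)) (Re (gdot z w)) (Re (l w)) => a b x h1 h2.
  (* This square yields [(b - x)^2 <= 2 (a - x)^2 + 2 (a - b)^2 <= 4 e gsq w]. *)
  by have := sqr_ge0 (a - x + (a - b)); nra.
exists z => // w Dw; apply/eqP; rewrite -subr_eq0; apply/eqP; apply: complex_eqP; first exact: Re0E.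
(* The real part at [i w] is the imaginary part at [w]. *)
have := Re0E _ (domZ gP 'i%C Dw).
by rewrite (semidotZr gP)// lZ// !ReImE /=; lra.
Qed.

Lemma resolvent_exists v :
  {r | fdom q r /\ forall w, fdom q w -> gdot r w = '[v, w]}.
Proof.
apply: cid.
have [|a u w _ _|w Dw|r Dr rP] := @riesz (fun w => '[v, w]) (hsq v); first exact: hsq_ge0.
- by rewrite hdotDr hdotZr.
- apply: (le_trans (semidot_cauchy_Re (semidot_hdot H) _ _)) => //.
  by apply: ler_wpM2l; [exact: hsq_ge0|exact: hsq_le_gsq].
- by exists r.
Qed.

(* (1 + h)^-1, for the positive operator h of which [q] is the form *)
Definition resolvent v := projT1 (resolvent_exists v).
Local Notation X := resolvent.

Lemma dom_resolvent v : fdom q (X v).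
Proof. by rewrite /X; case: resolvent_exists => r []. Qed.
Hint Resolve dom_resolvent : core.

Lemma gdot_resolvent v w : fdom q w -> gdot (X v) w = '[v, w].
Proof. by rewrite /X; case: resolvent_exists => r [? h] /h. Qed.

Lemma gdot_resolventr v w : fdom q v -> gdot v (X w) = '[v, w].
Proof. by move=> Dv; rewrite (semidotC gP)// gdot_resolvent// -hdotC. Qed.

Lemma hdot_resolvent v w : '[X v, w] = '[v, X w].
Proof. by rewrite -gdot_resolventr// gdot_resolvent. Qed.

(** Formally [h (1 + h)^-1 = 1 - (1 + h)^-1]. *)
Lemma form_resolvent v w : fdom q w -> q (X v) w = '[v - X v, w].
Proof.
move=> Dw; have := gdot_resolvent v Dw.
by rewrite /gdot hdotBl => <-; ring.
Qed.

Lemma resolvent_unique r v : fdom q r -> (forall w, fdom q w -> gdot r w = '[v, w]) ->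
  r = X v.
Proof.
move=> Dr h; apply/eqP; rewrite -subr_eq0; apply/eqP.
apply: gdot_sep => [|w Dw]; first exact: (domB gP).
by rewrite (semidotBl gP)// gdot_resolvent// h// subrr.
Qed.

Lemma resolventP a u v : X (a *: u + v) = a *: X u + X v.
Proof.
apply/esym/resolvent_unique => [|w Dw]; first exact: (semidot_domP gP).
by rewrite (semidotP gP)// !gdot_resolvent// hdotDl hdotZl.
Qed.

Lemma resolventD u v : X (u + v) = X u + X v.
Proof. by rewrite -[u in LHS]scale1r resolventP scale1r. Qed.
Lemma resolvent0 : X 0 = 0.
Proof. by have /eqP := resolventD 0 0; rewrite addr0 addrC -subr_eq subrr eq_sym => /eqP. Qed.
Lemma resolventZ a u : X (a *: u) = a *: X u.
Proof. by rewrite -[a *: u]addr0 resolventP resolvent0 addr0. Qed.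
Lemma resolventN u : X (- u) = - X u.
Proof. by rewrite -scaleN1r resolventZ scaleN1r. Qed.
Lemma resolventB u v : X (u - v) = X u - X v.
Proof. by rewrite resolventD resolventN. Qed.

Lemma resolvent_inj v : fdom q v -> X v = 0 -> v = 0.
Proof.
move=> Dv Xv0; apply: hsq_eq0; rewrite /hsq -gdot_resolvent// Xv0 (semidot0l gP)//.
Qed.

(* The Cayley transform (h - 1) / (h + 1): since
   [1 - cayley ^ 2 = 4 h (1 + h)^-2], telescoping its powers writes the inner
   product as a sum of forms. *)
Definition cayley v := v - 2 *: X v.
Local Notation C := cayley.

Lemma cayleyP a u v : C (a *: u + v) = a *: C u + C v.
Proof.
rewrite /C resolventP [2 *: (_ + _)]scalerDr scalerBr !scalerA [2 * a]mulrC opprD.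
by rewrite addrACA.
Qed.

Lemma cayleyB u v : C (u - v) = C u - C v.
Proof. by have := cayleyP (-1) v u; rewrite !scaleN1r ![- _ + _]addrC. Qed.

Lemma dom_cayley v : fdom q v -> fdom q (C v).
Proof. by move=> Dv; apply: (domB gP) => //; exact: (domZ gP). Qed.

Lemma hdot_cayley v w : '[C v, w] = '[v, C w].
Proof. by rewrite /C hdotBl hdotBr hdotZl hdotZr hdot_resolvent conjC_nat. Qed.

Lemma cayley_resolvent v : C (X v) = X (C v).
Proof. by rewrite /C resolventB resolventZ. Qed.

Lemma gdot_cayley v w : fdom q v -> fdom q w -> gdot (C v) w = gdot v (C w).
Proof.
move=> Dv Dw; rewrite /C (semidotBl gP)//; last exact: (domZ gP).
rewrite (semidotBr gP)//; last exact: (domZ gP).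
by rewrite (semidotZl gP)// (semidotZr gP)// gdot_resolvent// gdot_resolventr// conjC_nat.
Qed.

Lemma cayley_cayley v : v - C (C v) = 4 *: (X v - X (X v)).
Proof.
rewrite /C resolventB resolventZ; move: (X v) (X (X v)) => a b.
rewrite !opprB addrCA [v + _]addrC addrNK scalerBr scalerA addrAC -scalerDl.
have -> : (2 + 2 : R[i]) = 4 by ring.
have -> : (2 * 2 : R[i]) = 4 by ring.
by rewrite -scalerBr.
Qed.

Lemma hdot_cayley_telescope v w : '[v, w] - '[C v, C w] = 4 * q (X v) (X w).
Proof.
rewrite form_resolvent// -[LHS]/(_ - '[_, C w]) -hdot_cayley -hdotBl.
by rewrite cayley_cayley hdotZl -resolventB hdot_resolvent.
Qed.

(** Expanding with the resolvent identities, the gap is [4 ((v, v) - (v, X v))], and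
    [(v, v) - (v, X v)] is the squared norm of [v - X v] plus [q (X v) (X v)]. *)
Lemma gsq_cayley_le v : fdom q v -> gsq (C v) <= gsq v.
Proof.
move=> Dv; have DX : fdom q (2 *: X v) by exact: (domZ gP).
rewrite /gsq /C (ReB_sqrB gP)// (semidotZr gP)// [gdot (_ *: _) (_ *: _)](semidotZl gP)//.
rewrite (semidotZr gP)// gdot_resolventr// gdot_resolvent// !conjC_nat !ReImE.
suff : 0 <= Re ('[v, v] - '[v, X v]) by rewrite !ReImE; lra.
have -> : '[v, v] - '[v, X v] = '[v - X v, v - X v] + q (X v) (X v).
  by rewrite form_resolvent// !hdotBl !hdotBr ['[X v, v]]hdot_resolvent; ring.
by rewrite cReD addr_ge0 ?hsq_ge0 ?(semidot_ge0 qP).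
Qed.

Lemma dom_iter_cayley n v : fdom q v -> fdom q (iter n C v).
Proof. by move=> Dv; elim: n => // n IH; exact: dom_cayley. Qed.

Lemma hdot_iter_cayley n v w : '[iter n C v, w] = '[v, iter n C w].
Proof.
by elim: n w => // n IH w; rewrite iterS hdot_cayley IH -iterSr.
Qed.

Lemma gdot_iter_cayley n v w : fdom q v -> fdom q w ->
  gdot (iter n C v) w = gdot v (iter n C w).
Proof.
move=> Dv; elim: n w => // n IH w Dw; rewrite iterS gdot_cayley//; last exact: dom_iter_cayley.
by rewrite IH -?iterSr//; exact: dom_cayley.
Qed.

Lemma iter_cayleyP n a u v : iter n C (a *: u + v) = a *: iter n C u + iter n C v.
Proof. by elim: n => // n IH; rewrite !iterS IH cayleyP. Qed.

Lemma iter_cayleyB n u v : iter n C (u - v) = iter n C u - iter n C v.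
Proof. by have := iter_cayleyP n (-1) v u; rewrite !scaleN1r ![- _ + _]addrC. Qed.

Lemma iter_cayleyZ n a v : iter n C (a *: v) = a *: iter n C v.
Proof.
have C0 : iter n C 0 = 0 by have := iter_cayleyB n 0 0; rewrite !subrr.
by rewrite -[a *: v]addr0 iter_cayleyP C0 addr0.
Qed.

Lemma iter_cayley_resolvent n v : iter n C (X v) = X (iter n C v).
Proof. by elim: n => // n IH; rewrite !iterS IH cayley_resolvent. Qed.

Lemma gsq_iter_cayley_le n v : fdom q v -> gsq (iter n C v) <= gsq v.
Proof.
move=> Dv; elim: n => // n IH; apply: le_trans IH; rewrite iterS.
by apply: gsq_cayley_le; exact: dom_iter_cayley.
Qed.

Lemma hdot_telescope m v w :
  '[v, w] = 4 * \sum_(k < m) q (X (iter k C v)) (X (iter k C w)) +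
            '[iter m.*2 C v, w].
Proof.
(* Self-adjointness shares the [2m] powers between the two sides; in this form consecutive
   remainders differ by one term of the sum. *)
have -> : '[iter m.*2 C v, w] = '[iter m C v, iter m C w].
  by rewrite -addnn iterD hdot_iter_cayley.
elim: m => [|m IH]; first by rewrite big_ord0 mulr0 add0r.
rewrite big_ord_recr /= mulrDr -hdot_cayley_telescope {1}IH; ring.
Qed.

(** From [1 - C^2 = 4 X (1 - X)] and injectivity of [X] on the domain one gets [X z = z], formally
    [h z = 0]. *)
Lemma form_fixed_eq0 z : fdom q z -> C (C z) = z -> q z z = 0.
Proof.
move=> Dz Cz.
have XE : X (z - X z) = 0.
  have := cayley_cayley z; rewrite Cz subrr -resolventB => /esym/eqP.
  by rewrite scaler_eq0 pnatr_eq0 /= => /eqP.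
have zE : z - X z = 0 by apply: resolvent_inj => //; exact: (domB gP).
have /eqP := zE; rewrite subr_eq0 => /eqP zX.
by rewrite [in X in q X _]zX form_resolvent// zE (semidot0l (semidot_hdot H)).
Qed.

(** This takes the place of the spectral theorem. The numbers [gsq (C^n v)] decrease, hence
    converge, and this makes the even powers [C^2n v] Cauchy for the graph norm. Their limit is
    fixed by [C^2], so the form vanishes there by [form_fixed_eq0]. *)
Lemma form_iter_cayley_cvg v (e : R) : fdom q v -> 0 < e ->
  exists N, forall m, (N <= m)%N -> Re (q (iter m.*2 C v) (iter m.*2 C v)) < e.
Proof.
move=> Dv e0; have DC n := dom_iter_cayley n Dv.
pose a n := gsq (iter n C v).
(* Only even powers are used, so that the exponents [2i] and [2j] can be redistributed as [i + j] on
   each side. *)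
have gE i j : gdot (iter i.*2 C v) (iter j.*2 C v) = gdot (iter (i + j) C v) (iter (i + j) C v).
  rewrite -[in LHS]addnn iterD gdot_iter_cayley// -iterD.
  rewrite gdot_iter_cayley// -iterD -addnn.
  by rewrite [RHS]gdot_iter_cayley// -iterD; congr (gdot _ (iter _ _ _)); lia.
have a0 n : 0 <= a n by exact: (semidot_ge0 gP).
have adec i j : (i <= j)%N -> a j <= a i.
  move=> ij; rewrite -(subnK ij) /a iterD; exact: gsq_iter_cayley_le.
have hinf : has_inf (range a).
  by split; [exists (a 0%N), 0%N|exists 0 => _ [n _ <-]].
pose m := inf (range a).
have ma n : m <= a n by apply: ge_inf; [exact: hinf.2|exists n].
have acvg (d : R) : 0 < d -> exists N, forall n, (N <= n)%N -> a n < m + d.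
  move=> d0; have [_ [N _ <-] h] := inf_adherent d0 hinf.
  by exists N => n /adec; rewrite -/m in h; lra.
pose s n := iter n.*2 C v.
have sC (d : R) : 0 < d -> exists N, forall i j, (N <= i)%N -> (N <= j)%N ->
      hsq (s i - s j) + Re (form_val q (s i - s j) (s i - s j)) < d.
  move=> d0; have [N NP] := acvg (d / 2) ltac:(lra).
  (* The squared distance is [a (2i) - 2 a (i + j) + a (2j)]; all three values lie in
     [[m, m + d/2)]. *)
  exists N => i j Ni Nj; rewrite -gsqE /gsq (ReB_sqrB gP (DC _) (DC _)).
  rewrite /s !gE -!/(gsq _) -!/(a _).
  have := NP (i + i)%N ltac:(lia); have := NP (j + j)%N ltac:(lia); have := ma (i + j)%N; lra.
have [z Dz zP] := form_complete (fun n => DC n.*2) sC.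
have CCz : C (C z) = z.
  have D2 : fdom q (C (C z)) by do 2!apply: dom_cayley.
  apply/eqP; rewrite -subr_eq0; apply/eqP; apply: gdot_eq0; first exact: (domB gP).
  apply: (@eq0_small _ _ 4) => // [|d d0]; first by apply: (semidot_ge0 gP); exact: (domB gP).
  have [N NP] := zP _ d0.
  have := NP N (leqnn _); have := NP N.+1 (leqnSn _); rewrite -!gsqE => h1 h2.
  have Ds : fdom q (s N - z) by apply: (domB gP) => //; exact: DC.
  have Ds' : fdom q (s N.+1 - z) by apply: (domB gP) => //; exact: DC.
  have h3 : gsq (C (C (s N - z))) <= gsq (s N - z).
    by apply: (le_trans (gsq_cayley_le (dom_cayley Ds))); exact: gsq_cayley_le.
  (* Both summands have squared graph norm below [d], the second because [C] is a contraction; hence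
     the constant 4. *)
  have -> : C (C z) - z = (s N.+1 - z) + - C (C (s N - z)).
    have -> : C (C (s N - z)) = s N.+1 - C (C z) by rewrite [C (s N - z)]cayleyB [LHS]cayleyB.
    by move: (s N.+1) (C (C z)) => x y; rewrite opprB [RHS]addrC addrA addrNK.
  have D3 : fdom q (C (C (s N - z))) by do 2!apply: dom_cayley.
  apply: (le_trans (ReB_sqrD_le gP Ds' (domN gP D3))).
  rewrite (semidotNl gP) ?(semidotNr gP)//; last exact: (domN gP).
  rewrite opprK -!/(gsq _); lra.
have qz := form_fixed_eq0 Dz CCz.
have [N NP] := zP (e / 2) ltac:(lra).
exists N => k /NP; have Ds : fdom q (s k - z) by apply: (domB gP) => //; exact: DC.
have := ReB_sqrD_le qP Ds Dz; rewrite subrK qz cRe0 mulr0 addr0 -/(s k).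
by have := hsq_ge0 (s k - z); lra.
Qed.

End closed_forms.

Arguments gdot {R H} q u v.
Arguments gsq {R H} q u.
Arguments resolvent {R H} q v.
Arguments cayley {R H} q v.

(** * Square-integrable functions *)

Section transfer.
Context d1 d2 (T1 : measurableType d1) (T2 : measurableType d2) (R : realType).
Context (m1 : {measure set T1 -> \bar R}) (m2 : {measure set T2 -> \bar R}).
Context (phi : T1 -> T2) (mphi : measurable_fun [set: T1] phi).
Hypothesis phim : forall A, measurable A -> m1 (phi @^-1` A) = m2 A.
Let mphi_mixin := isMeasurableFun.Build _ _ _ _ _ mphi.
Let mphi_pack : {mfun _ >-> _} := HB.pack phi mphi_mixin.

(** Change of variables is set up with two measures, so that it covers translations, where they
    agree, as well as inversion, where they may differ. *)
Lemma ge0_integral_transfer (f : T2 -> \bar R) : measurable_fun [set: T2] f ->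
  (forall x, 0 <= f x)%E -> (\int[m1]_x f (phi x) = \int[m2]_x f x)%E.
Proof.
move=> mf f0; rewrite [RHS](eq_measure_integral (pushforward m1 mphi_pack)); last first.
  by move=> A mA _; rewrite -phim.
by rewrite [RHS]ge0_integral_pushforward.
Qed.

Lemma integrable_transfer (f : T2 -> \bar R) : measurable_fun [set: T2] f ->
  m1.-integrable setT (f \o phi) <-> m2.-integrable setT f.
Proof.
move=> mf.
have E : (\int[m1]_x `|f (phi x)| = \int[m2]_x `|f x|)%E.
  by apply: (ge0_integral_transfer (f := fun x => `|f x|%E)) => //; exact: measurableT_comp.
split => /integrableP[mf' If]; apply/integrableP; split => //.
- by rewrite -E.
- exact: measurableT_comp.
- by rewrite /comp E.
Qed.

Lemma integral_transfer (f : T2 -> \bar R) : measurable_fun [set: T2] f ->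
  m2.-integrable setT f -> (\int[m1]_x f (phi x) = \int[m2]_x f x)%E.
Proof.
move=> mf If; rewrite [RHS](eq_measure_integral (pushforward m1 mphi_pack)); last first.
  by move=> A mA _; rewrite -phim.
by rewrite [RHS]integral_pushforward//; exact/integrable_transfer.
Qed.

End transfer.

Lemma sum_nil_fun (T : Type) (V : nmodType) I (P : pred I) (F : I -> T -> V) :
  (fun x => \sum_(j <- [::] | P j) F j x) = cst 0.
Proof. by apply/funext => x; rewrite big_nil. Qed.

Lemma sum_cons_fun (T : Type) (V : nmodType) I i (r : seq I) (P : pred I) (F : I -> T -> V) :
  (fun x => \sum_(j <- i :: r | P j) F j x) =
  if P i then (fun x => F i x + \sum_(j <- r | P j) F j x)
  else (fun x => \sum_(j <- r | P j) F j x).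
Proof. by case: ifP => Pi; apply/funext => x; rewrite big_cons Pi. Qed.

(** * Integrals and the L^2 inner product of complex functions *)

Section square_integrable.
Context d (T : measurableType d) (R : realType).
Variable m : {measure set T -> \bar R}.
Implicit Types f g : T -> R[i].

Lemma CmeasurableD f g : Cmeasurable f -> Cmeasurable g -> Cmeasurable (fun x => f x + g x).
Proof.
move=> [rf jf] [rg jg]; split; under eq_fun do rewrite !ReImE; exact: measurable_funD.
Qed.

Lemma CmeasurableM f g : Cmeasurable f -> Cmeasurable g -> Cmeasurable (fun x => f x * g x).
Proof.
move=> [rf jf] [rg jg]; split; under eq_fun do rewrite !ReImE.
- by apply: measurable_funB; exact: measurable_funM.
- by apply: measurable_funD; exact: measurable_funM.
Qed.

Lemma Cmeasurable_cst a : Cmeasurable (cst a : T -> R[i]).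
Proof. by split; exact: measurable_cst. Qed.

Lemma CmeasurableZ a f : Cmeasurable f -> Cmeasurable (fun x => a * f x).
Proof. by apply: CmeasurableM; exact: Cmeasurable_cst. Qed.

Lemma CmeasurableJ f : Cmeasurable f -> Cmeasurable (fun x => Num.conj (f x)).
Proof.
move=> [rf jf]; split; first by under eq_fun do rewrite cReJ.
by under eq_fun do rewrite cImJ; exact: measurableT_comp.
Qed.

Lemma measurable_csq f : Cmeasurable f -> measurable_fun [set: T] (fun x => csq (f x)).
Proof. by move=> [rf jf]; apply: measurable_funD; exact: measurable_funX. Qed.

Lemma CintegrableD f g : Cintegrable m f -> Cintegrable m g ->
  Cintegrable m (fun x => f x + g x).
Proof.
move=> [rf jf] [rg jg]; split; under eq_fun do rewrite !ReImE EFinD; exact: integrableD.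
Qed.

Lemma CintegrableZ a f : Cintegrable m f -> Cintegrable m (fun x => a * f x).
Proof.
move=> [rf jf]; split.
- under eq_fun do rewrite cReM EFinB !EFinM; apply: integrableB => //; exact: integrableZl.
- under eq_fun do rewrite cImM EFinD !EFinM; apply: integrableD => //; exact: integrableZl.
Qed.

Lemma CintegralD f g : Cintegrable m f -> Cintegrable m g ->
  Cintegral m (fun x => f x + g x) = Cintegral m f + Cintegral m g.
Proof.
move=> [rf jf] [rg jg]; apply: complex_eqP => /=.
- by under eq_Rintegral do rewrite cReD; rewrite RintegralD.
- by under eq_Rintegral do rewrite cImD; rewrite RintegralD.
Qed.

Lemma CintegralZ a f : Cintegrable m f ->
  Cintegral m (fun x => a * f x) = a * Cintegral m f.
Proof.
move=> [rf jf].
have rI b : m.-integrable setT (EFin \o (fun x => b * Re (f x))).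
  exact: (integrableZl measurableT b rf).
have jI b : m.-integrable setT (EFin \o (fun x => b * Im (f x))).
  exact: (integrableZl measurableT b jf).
apply: complex_eqP; rewrite !ReImE /=.
- by under eq_Rintegral do rewrite cReM; rewrite RintegralB// !RintegralZl.
- by under eq_Rintegral do rewrite cImM; rewrite RintegralD// !RintegralZl.
Qed.

Lemma CintegralJ f : Cintegrable m f ->
  Cintegral m (fun x => Num.conj (f x)) = Num.conj (Cintegral m f).
Proof.
move=> [rf jf]; apply: complex_eqP; rewrite !ReImE /=.
- by under eq_Rintegral do rewrite cReJ.
- under eq_Rintegral do rewrite cImJ -mulN1r.
  by rewrite RintegralZl// mulN1r.
Qed.

Lemma Cintegral0 : Cintegral m (cst 0 : T -> R[i]) = 0.
Proof. by apply: complex_eqP; rewrite /= /Rintegral integral0. Qed.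

Lemma Cintegrable0 : Cintegrable m (cst 0 : T -> R[i]).
Proof. by split; exact: integrable0. Qed.

Lemma Cintegrable_sum I (r : seq I) (P : pred I) (F : I -> T -> R[i]) :
  (forall i, P i -> Cintegrable m (F i)) ->
  Cintegrable m (fun x => \sum_(i <- r | P i) F i x).
Proof.
move=> mF; elim: r => [|i r IH].
  by rewrite sum_nil_fun; exact: Cintegrable0.
rewrite sum_cons_fun.
by case: ifPn => // Pi; apply: CintegrableD => //; exact: mF.
Qed.

Lemma Cintegral_sum I (r : seq I) (P : pred I) (F : I -> T -> R[i]) :
  (forall i, P i -> Cintegrable m (F i)) ->
  Cintegral m (fun x => \sum_(i <- r | P i) F i x) =
  \sum_(i <- r | P i) Cintegral m (F i).
Proof.
move=> mF; elim: r => [|i r IH].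
  by rewrite sum_nil_fun Cintegral0 big_nil.
rewrite sum_cons_fun big_cons.
case: ifPn => // Pi; rewrite CintegralD ?IH//; first exact: mF.
exact: Cintegrable_sum.
Qed.

(** Square integrability without the L^p norm, so that it can be handled by comparison of integrals;
    [CLfun2] translates. *)
Definition sqint f :=
  Cmeasurable f /\ m.-integrable setT (fun x => (csq (f x))%:E).

Lemma sqintP f : Cmeasurable f -> (\int[m]_x (csq (f x))%:E < +oo)%E -> sqint f.
Proof.
move=> mf If; split => //; apply/integrableP; split.
  exact/measurable_EFinP/measurable_csq.
by under eq_integral do rewrite gee0_abs ?lee_fin ?csq_ge0//.
Qed.

Lemma CLfun2 f : CLfun m 2%:E f <-> sqint f.
Proof.
have E : (\int[m]_x (csq (f x))%:E = \int[m]_x `|(Re `|f x|)%:E| `^ 2)%E.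
  apply: eq_integral => x _.
  by rewrite gee0_abs ?lee_fin ?Re_normc_ge0// poweR_EFin powR_mulrn ?Re_normc_ge0// norm_csq.
have I0 : (0 <= \int[m]_x (csq (f x))%:E)%E.
  by apply: integral_ge0 => x _; rewrite lee_fin csq_ge0.
rewrite /CLfun /finite_norm Lnorm.unlock.
split => [[mf If]|[mf If]]; first last.
  split => //; rewrite -E; apply: poweR_lty.
  by rewrite -ge0_fin_numE//; exact: integrable_fin_num.
by apply: sqintP => //; rewrite E; apply: (lty_poweRy (r := 2^-1)).
Qed.

Lemma sqintJ f : sqint f -> sqint (fun x => Num.conj (f x)).
Proof.
move=> [mf If]; split; first exact: CmeasurableJ.
by under eq_fun do rewrite csqJ.
Qed.

(** The real and imaginary parts of [f g] are dominated by [|f|^2 + |g|^2]; each of the four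
    inequalities is exhibited as a sum of squares. *)
Lemma sqint_prod f g : sqint f -> sqint g -> Cintegrable m (fun x => f x * g x).
Proof.
move=> [mf If] [mg Ig].
have Ifg : m.-integrable setT (fun x => (csq (f x) + csq (g x))%:E).
  by under eq_fun do rewrite EFinD; exact: integrableD.
have [mr mj] := CmeasurableM mf mg.
have normE x : `|(csq (f x) + csq (g x))%:E|%E = (csq (f x) + csq (g x))%:E.
  by rewrite gee0_abs// lee_fin addr_ge0 ?csq_ge0.
split; apply: (le_integrable _ _ _ Ifg) => //.
- exact/measurable_EFinP.
- move=> x _; rewrite normE lee_fin ler_norml cReM /csq.
  apply/andP; split; rewrite -subr_ge0.
  + rewrite (_ : _ - _ = ((Re (f x) + Re (g x)) ^+ 2 + (Im (f x) - Im (g x)) ^+ 2 +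
      Re (f x) ^+ 2 + Re (g x) ^+ 2 + Im (f x) ^+ 2 + Im (g x) ^+ 2) / 2); last by field.
    by rewrite divr_ge0 ?addr_ge0 ?sqr_ge0.
  + rewrite (_ : _ - _ = ((Re (f x) - Re (g x)) ^+ 2 + (Im (f x) + Im (g x)) ^+ 2 +
      Re (f x) ^+ 2 + Re (g x) ^+ 2 + Im (f x) ^+ 2 + Im (g x) ^+ 2) / 2); last by field.
    by rewrite divr_ge0 ?addr_ge0 ?sqr_ge0.
- exact/measurable_EFinP.
- move=> x _; rewrite normE lee_fin ler_norml cImM /csq.
  apply/andP; split; rewrite -subr_ge0.
  + rewrite (_ : _ - _ = ((Re (f x) + Im (g x)) ^+ 2 + (Im (f x) + Re (g x)) ^+ 2 +
      Re (f x) ^+ 2 + Re (g x) ^+ 2 + Im (f x) ^+ 2 + Im (g x) ^+ 2) / 2); last by field.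
    by rewrite divr_ge0 ?addr_ge0 ?sqr_ge0.
  + rewrite (_ : _ - _ = ((Re (f x) - Im (g x)) ^+ 2 + (Im (f x) - Re (g x)) ^+ 2 +
      Re (f x) ^+ 2 + Re (g x) ^+ 2 + Im (f x) ^+ 2 + Im (g x) ^+ 2) / 2); last by field.
    by rewrite divr_ge0 ?addr_ge0 ?sqr_ge0.
Qed.

Definition L2dot f g : R[i] := Cintegral m (fun x => f x * Num.conj (g x)).

Lemma sqint_prodJ f g : sqint f -> sqint g ->
  Cintegrable m (fun x => f x * Num.conj (g x)).
Proof. by move=> If Ig; apply: sqint_prod => //; exact: sqintJ. Qed.

Lemma Re_L2dot f : Re (L2dot f f) = \int[m]_x csq (f x).
Proof.
by apply: eq_Rintegral => x _; rewrite cReM cReJ cImJ /csq; ring.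
Qed.

Lemma semidot_L2dot : semidot (sqint : set (T -> R[i])) L2dot.
Proof.
split.
- apply: sqintP; first exact: Cmeasurable_cst.
  rewrite (eq_integral (fun=> 0%E)) ?integral0// => x _.
  by rewrite /csq /= expr0n addr0.
- move=> a f g [mf If] [mg Ig].
  have mh : Cmeasurable (a *: f + g) by apply: CmeasurableD => //; exact: CmeasurableZ.
  split => //.
  have I2 : m.-integrable setT (fun x => (2 * csq a * csq (f x) + 2 * csq (g x))%:E).
    under eq_fun do rewrite EFinD !EFinM.
    by apply: integrableD => //; exact: integrableZl.
  apply: (le_integrable _ _ _ I2) => //; first exact/measurable_EFinP/measurable_csq.
  move=> x _; rewrite !gee0_abs ?lee_fin ?csq_ge0//; last first.
    by rewrite addr_ge0 ?mulr_ge0 ?csq_ge0.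
  rewrite -mulrA -csqM -[(a *: f + g) x]/(a * f x + g x) /csq cReD cImD.
  move: (Re (_ * _)) (Im (_ * _)) => u v; rewrite -subr_ge0.
  rewrite (_ : _ - _ = (u - Re (g x)) ^+ 2 + (v - Im (g x)) ^+ 2); last by ring.
  by rewrite addr_ge0 ?sqr_ge0.
- move=> a f g h If Ig Ih; rewrite /L2dot.
  transitivity (Cintegral m (fun x => a * (f x * Num.conj (h x)) + g x * Num.conj (h x))).
    by congr Cintegral; apply/funext => x; rewrite -[(a *: f + g) x]/(a * f x + g x); ring.
  rewrite CintegralD ?CintegralZ//; do ?exact: sqint_prodJ.
  by apply: CintegrableZ; exact: sqint_prodJ.
- move=> f g If Ig; rewrite /L2dot -CintegralJ; last exact: sqint_prodJ.
  by congr Cintegral; apply/funext => x; rewrite rmorphM /= conjCK mulrC.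
- move=> f If; rewrite Re_L2dot; apply: Rintegral_ge0 => x _; exact: csq_ge0.
Qed.

Lemma L2dotE f : sqint f -> (\int[m]_x (csq (f x))%:E = (Re (L2dot f f))%:E)%E.
Proof.
move=> [mf If]; rewrite Re_L2dot /Rintegral fineK//.
exact: integrable_fin_num.
Qed.

(** Lower semicontinuity of the L^2 norm under pointwise convergence of moduli; it is what makes the
    coefficient forms closed. *)
Lemma fatou_L2 (f_ : nat -> T -> R[i]) f (c : R) :
  (forall n, sqint (f_ n)) -> Cmeasurable f ->
  (forall x, (fun n => csq (f_ n x)) @ \oo --> csq (f x)) ->
  (forall n, Re (L2dot (f_ n) (f_ n)) <= c) ->
  sqint f /\ Re (L2dot f f) <= c.
Proof.
move=> If mf fcvg fc.
have le_c : (\int[m]_x (csq (f x))%:E <= c%:E)%E.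
  have := @fatou _ _ _ m setT measurableT (fun n x => (csq (f_ n x))%:E).
  rewrite (eq_integral (fun x => (csq (f x))%:E)); last first.
    move=> x _; have h : (fun n => (csq (f_ n x))%:E) @ \oo --> (csq (f x))%:E.
      by apply: cvg_EFin => //; [exact: nearW|exact: fcvg].
    by rewrite (cvg_limn_einf_sup h).1.
  move=> h; apply: (le_trans (h _ _)).
  - by move=> n; apply/measurable_EFinP/measurable_csq; exact: (If n).1.
  - by move=> n x _; rewrite lee_fin csq_ge0.
  - rewrite limn_einf_lim; apply: lime_le; first exact: is_cvg_einfs.
    apply: nearW => n; apply: le_trans (ereal_inf_lbound _) _; first by exists n => /=.
    by rewrite L2dotE// lee_fin.
have If' : sqint f by apply: sqintP => //; rewrite (le_lt_trans le_c)// ltry.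
by split => //; rewrite -lee_fin -L2dotE.
Qed.

End square_integrable.

(** * Change of variables for complex functions *)

Section Ctransfer.
Context d1 d2 (T1 : measurableType d1) (T2 : measurableType d2) (R : realType).
Context (m1 : {measure set T1 -> \bar R}) (m2 : {measure set T2 -> \bar R}).
Context (phi : T1 -> T2) (mphi : measurable_fun [set: T1] phi).
Hypothesis phim : forall A, measurable A -> m1 (phi @^-1` A) = m2 A.

Lemma Cmeasurable_comp (f : T2 -> R[i]) : Cmeasurable f -> Cmeasurable (f \o phi).
Proof.
by move=> [rf jf]; split; [exact: (measurableT_comp rf)|exact: (measurableT_comp jf)].
Qed.

Lemma Cintegral_transfer (f : T2 -> R[i]) : Cmeasurable f -> Cintegrable m2 f ->
  Cintegral m1 (f \o phi) = Cintegral m2 f.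
Proof.
move=> [/measurable_EFinP rf /measurable_EFinP jf] [If Jf].
apply: complex_eqP; rewrite /= /Rintegral; congr fine.
- exact: (integral_transfer mphi phim rf).
- exact: (integral_transfer mphi phim jf).
Qed.

Lemma sqint_transfer (f : T2 -> R[i]) : Cmeasurable f ->
  sqint m1 (f \o phi) <-> sqint m2 f.
Proof.
move=> mf; have mq := (measurable_csq mf); move/measurable_EFinP in mq.
by split => -[h1 h2]; split => //;
  [exact/(integrable_transfer mphi phim mq)|exact: Cmeasurable_comp
  |exact/(integrable_transfer mphi phim mq)].
Qed.

Lemma L2dot_transfer (f g : T2 -> R[i]) : sqint m2 f -> sqint m2 g ->
  L2dot m1 (f \o phi) (g \o phi) = L2dot m2 f g.
Proof.
move=> If Ig; apply: (Cintegral_transfer (f := fun x => f x * Num.conj (g x))).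
  by apply: CmeasurableM; [exact: If.1|apply: CmeasurableJ; exact: Ig.1].
exact: sqint_prodJ.
Qed.

End Ctransfer.

(** * Completeness and continuity expressed through [hsq] *)

Section hilbert_topology.
Context (R : realType) (H : hilbertType R).
Implicit Types u v w : H.

Lemma hnorm_lt u (e : R[i]) : 0 < e -> hsq u < Re e ^+ 2 -> `|u| < e.
Proof.
rewrite ltcE /= => /andP[/eqP e0 re0] ue; rewrite hnorm_hsq ltcE /= e0 eqxx /=.
rewrite -(@ltr_pXn2r _ 2) ?nnegrE ?sqrtr_ge0 ?sqr_sqrtr ?hsq_ge0//.
exact: ltW.
Qed.

Lemma hilbert_complete (s : nat -> H) :
  (forall e : R, 0 < e -> exists N, forall i j, (N <= i)%N -> (N <= j)%N ->
     hsq (s i - s j) < e) ->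
  exists z, forall e : R, 0 < e -> exists N, forall i, (N <= i)%N -> hsq (s i - z) < e.
Proof.
move=> sC.
have cs : cauchy (s @ \oo).
  apply: cauchy_exP => e e0; have re0 : 0 < Re e by move: e0; rewrite ltcE => /andP[].
  have [N NP] := sC (Re e ^+ 2) ltac:(by rewrite exprn_gt0).
  exists (s N), N => // i /= Ni; rewrite -ball_normE /ball_ /=; apply: hnorm_lt => //.
  exact: NP.
have /cauchy_cvg/cvg_ex[z zP] := cs.
exists z => e e0; move/cvgrPdist_lt : zP => /(_ (Num.sqrt e)%:C%C).
rewrite ltcR sqrtr_gt0 => /(_ e0)[N _ NP]; exists N => i Ni.
have := NP i Ni; rewrite /= distrC hnorm_hsq ltcR -(@ltr_pXn2r _ 2) ?nnegrE ?sqrtr_ge0//.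
by rewrite !sqr_sqrtr ?hsq_ge0 ?ltW.
Qed.

Lemma hdot_continuous v : continuous (fun u : H => Re '[u, v]) /\
  continuous (fun u : H => Im '[u, v]).
Proof.
have key (f : H -> R) : (forall x y, f (x - y) = f x - f y) ->
    (forall u, f u ^+ 2 <= 2 * (hsq u * hsq v)) -> continuous f.
  move=> fB fle u; apply/cvgrPdist_lt => e e0.
  have c0 : 0 < 2 * (hsq v + 1) by have := hsq_ge0 v; lra.
  (* Solves [2 d^2 (hsq v + 1) = e^2]; the added 1 covers [v = 0]. *)
  pose d : R := Num.sqrt (e ^+ 2 / (2 * (hsq v + 1))).
  have d0 : 0 < d%:C%C by rewrite ltcR sqrtr_gt0 divr_gt0 ?exprn_gt0.
  near=> x; rewrite -fB -(@ltr_pXn2r _ 2) ?nnegrE ?normr_ge0 ?(ltW e0)// real_normK ?num_real//.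
  apply: (le_lt_trans (fle _)).
  have h : hsq (u - x) < e ^+ 2 / (2 * (hsq v + 1)).
    have : `|u - x| < d%:C%C by near: x; exact: cvgr_dist_lt.
    rewrite hnorm_hsq ltcR -(@ltr_pXn2r _ 2) ?nnegrE ?sqrtr_ge0//.
    by rewrite !sqr_sqrtr ?hsq_ge0// ltW// divr_gt0 ?exprn_gt0.
  have {}h : hsq (u - x) * (2 * (hsq v + 1)) < e ^+ 2 by rewrite -ltr_pdivlMr.
  by have := hsq_ge0 v; have := hsq_ge0 (u - x); nra.
have le u := csq_hdot_le u v.
split; apply: key => [x y|u].
- by rewrite hdotBl cReD cReN.
- by apply: le_trans (le u); rewrite /csq lerDl sqr_ge0.
- by rewrite hdotBl cImD cImN.
- by apply: le_trans (le u); rewrite /csq lerDr sqr_ge0.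
Unshelve. all: by end_near.
Qed.

Lemma csq_hdot_cvg (s : nat -> H) z v :
  (forall e : R, 0 < e -> exists N, forall i, (N <= i)%N -> hsq (s i - z) < e) ->
  (fun n => csq '[s n, v]) @ \oo --> csq '[z, v].
Proof.
move=> sz.
have cs : s @ \oo --> z.
  apply/cvgrPdist_lt => e e0; have re0 : 0 < Re e by move: e0; rewrite ltcE => /andP[].
  have [N NP] := sz (Re e ^+ 2) ltac:(by rewrite exprn_gt0).
  exists N => // i /= Ni; rewrite distrC; apply: hnorm_lt => //; exact: NP.
have [cre cim] := hdot_continuous v.
have hre : (fun n => Re '[s n, v]) @ \oo --> Re '[z, v].
  exact: (continuous_cvg _ (cre z) cs).
have him : (fun n => Im '[s n, v]) @ \oo --> Im '[z, v].
  exact: (continuous_cvg _ (cim z) cs).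
by apply: cvgD; rewrite expr2; exact: cvgM.
Qed.

End hilbert_topology.

(** * Coefficient forms *)

Section coefficient_form.
Context d (T : measurableType d) (R : realType) (H : hilbertType R) (K : finType).
Context (m : K -> {measure set T -> \bar R}) (e : K -> T -> H).
Hypothesis me : forall k v, Cmeasurable (fun x => '[v, e k x]).

(** Each [k] carries its own measure. Later [k] is a pair of a choice between the two measures and
    the index of a vector of the family. *)
Definition coefs k v : T -> R[i] := fun x => '[v, e k x].

Definition coef_dom : set H := [set v | forall k, sqint (m k) (coefs k v)].

Definition coef_dot v w := \sum_k L2dot (m k) (coefs k v) (coefs k w).

Lemma coefsP k a u v : coefs k (a *: u + v) = a *: coefs k u + coefs k v.
Proof. by apply/funext => x; rewrite /coefs hdotDl hdotZl. Qed.

Lemma semidot_coef k : semidot [set v | sqint (m k) (coefs k v)]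
  (fun v w => L2dot (m k) (coefs k v) (coefs k w)).
Proof. exact: (semidot_comp (coefsP k) (semidot_L2dot (m k))). Qed.

Lemma semidot_coef_dot : semidot coef_dom coef_dot.
Proof. exact: (semidot_sum semidot_coef). Qed.

Lemma coef_dot_ge k v : coef_dom v ->
  Re (L2dot (m k) (coefs k v) (coefs k v)) <= Re (coef_dot v v).
Proof.
move=> Dv; rewrite cRe_sum (bigD1 k)//= lerDl sumr_ge0// => j _.
exact: (semidot_ge0 (semidot_coef j) (Dv j)).
Qed.

(** The sequence has a limit [z] in [H], along which all coefficients converge pointwise. Fatou's
    lemma turns the Cauchy bound on [s i - s j] into the same bound on [s i - z]. *)
Lemma coef_dot_complete (s : nat -> H) : (forall n, coef_dom (s n)) ->
  (forall e : R, 0 < e -> exists N, forall i j, (N <= i)%N -> (N <= j)%N ->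
    hsq (s i - s j) + Re (coef_dot (s i - s j) (s i - s j)) < e) ->
  exists2 z, coef_dom z & forall e : R, 0 < e -> exists N, forall i, (N <= i)%N ->
    hsq (s i - z) + Re (coef_dot (s i - z) (s i - z)) < e.
Proof.
move=> Ds sC; have DB u v : coef_dom u -> coef_dom v -> coef_dom (u - v).
  exact: (domB semidot_coef_dot).
have pos u : coef_dom u -> 0 <= Re (coef_dot u u) by exact: (semidot_ge0 semidot_coef_dot).
have [|z zP] := @hilbert_complete _ _ s.
  move=> c c0; have [N NP] := sC c c0; exists N => i j Ni Nj.
  by have := NP i j Ni Nj; have := pos _ (DB _ _ (Ds i) (Ds j)); lra.
have lim (c : R) : 0 < c -> exists N, forall i, (N <= i)%N -> coef_dom (s i - z) /\
    forall k, Re (L2dot (m k) (coefs k (s i - z)) (coefs k (s i - z))) <= c.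
  move=> c0; have [N NP] := sC c c0; exists N => i Ni.
  suff h k : sqint (m k) (coefs k (s i - z)) /\
      Re (L2dot (m k) (coefs k (s i - z)) (coefs k (s i - z))) <= c.
    by split => k; have [] := h k.
  (* The shift by [N] makes the Cauchy bound valid for every [n], as Fatou's lemma is stated. *)
  apply: (@fatou_L2 _ _ _ _ (fun n => coefs k (s i - s (n + N)%N))).
  - by move=> n; apply: DB.
  - exact: me.
  - move=> x; apply: csq_hdot_cvg => r r0; have [M MP] := zP r r0; exists M => n Mn.
    rewrite (_ : _ - _ = - (s (n + N)%N - z)); last first.
      by rewrite !opprB addrC addrA addrNK.
    by rewrite /hsq (semidotNl (semidot_hdot H))// (semidotNr (semidot_hdot H))// opprK;
      apply: MP; rewrite (leq_trans Mn)// leq_addr.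
  - move=> n; apply: (le_trans (coef_dot_ge _ _)); first exact: DB.
    have := NP i (n + N)%N Ni (leq_addl _ _); have := hsq_ge0 (s i - s (n + N)%N); lra.
exists z.
  have [N NP] := lim 1 ltr01; have [Dz _] := NP N (leqnn _).
  by rewrite -[z](subKr (s N)); exact: DB.
(* One share of [c] for each of the [#|K|] summands, one for [hsq], and one to spare. *)
move=> c c0; have K0 : 0 < #|K|%:R + 2 :> R by rewrite ltr_wpDl.
have cK : 0 < c / (#|K|%:R + 2) by rewrite divr_gt0.
have [N NP] := lim _ cK; have [M MP] := zP _ cK.
exists (maxn N M) => i; rewrite geq_max => /andP[/NP[Dz hz] /MP hM].
have : Re (coef_dot (s i - z) (s i - z)) <= #|K|%:R * (c / (#|K|%:R + 2)).
  rewrite cRe_sum mulr_natl -sumr_const; apply: ler_sum => k _; exact: hz.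
have : (#|K|%:R + 2) * (c / (#|K|%:R + 2)) = c by field; rewrite gt_eqF.
by move: (c / _) cK hM => x; lra.
Qed.

Definition coef_form := ClosedForm semidot_coef_dot coef_dot_complete.

End coefficient_form.

(** * Representations with square-integrable coefficients *)

Section topological_group.
Context (R : realType) (G : topGroupType).
Implicit Types g h : G.

Lemma continuous_measurable (f : G -> G) :
  continuous f -> measurable_fun [set: borel G] (f : borel G -> borel G).
Proof.
move=> /continuousP cf; apply: (@measurability _ _ (borel G) (borel G) _ _ (@open G)) => //.
move=> _ [B oB <-].
by apply: sub_sigma_algebra; rewrite setTI; exact: cf.
Qed.

Lemma continuous_measurable_real (f : G -> R) :
  continuous f -> measurable_fun [set: borel G] (f : borel G -> R).
Proof.
move=> /continuousP cf; apply: (measurability _ (RGenOpens.measurableE R)).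
by move=> _ [_ [a [b ->] <-]]; apply: sub_sigma_algebra; rewrite setTI; exact/cf/interval_open.
Qed.

Lemma continuous_mulgl g : continuous (fun x : G => (g * x)%g).
Proof.
move=> x; apply: (@continuous_comp _ _ _ (fun x : G => (g, x)) (fun z : G * G => (z.1 * z.2)%g)).
  by apply: cvg_pair; [exact: cvg_cst|exact: cvg_id].
exact: mulg_continuous.
Qed.

Lemma continuous_mulgr g : continuous (fun x : G => (x * g)%g).
Proof.
move=> x; apply: (@continuous_comp _ _ _ (fun x : G => (x, g)) (fun z : G * G => (z.1 * z.2)%g)).
  by apply: cvg_pair; [exact: cvg_id|exact: cvg_cst].
exact: mulg_continuous.
Qed.

Lemma measurable_mulgl g :
  measurable_fun [set: borel G] ((fun x : G => (g * x)%g) : borel G -> borel G).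
Proof. by apply: continuous_measurable; exact: continuous_mulgl. Qed.

Lemma measurable_mulgr g :
  measurable_fun [set: borel G] ((fun x : G => (x * g)%g) : borel G -> borel G).
Proof. by apply: continuous_measurable; exact: continuous_mulgr. Qed.

Lemma measurable_invg :
  measurable_fun [set: borel G] ((fun x : G => x^-1%g) : borel G -> borel G).
Proof. by apply: continuous_measurable; exact: invg_continuous. Qed.

Lemma image_mulgl g (A : set G) :
  [set (g * x)%g | x in A] = (fun x : G => (g^-1 * x)%g) @^-1` A.
Proof.
apply/seteqP; split => x; first by move=> [y Ay <-]; rewrite /preimage /= mulKg.
by move=> Ax; exists (g^-1 * x)%g => //; rewrite mulVKg.
Qed.

Lemma image_mulgr g (A : set G) :
  [set (x * g)%g | x in A] = (fun x : G => (x * g^-1)%g) @^-1` A.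
Proof.
apply/seteqP; split => x; first by move=> [y Ay <-]; rewrite /preimage /= mulgK.
by move=> Ax; exists (x * g^-1)%g => //; rewrite mulgVK.
Qed.

Context (mu : {measure set (borel G) -> \bar R}).

Lemma left_invariant_preimage (muL : left_invariant mu) g (A : set (borel G)) :
  measurable A -> mu ((fun x : G => (g * x)%g) @^-1` A) = mu A.
Proof. by move=> mA; rewrite -(muL g^-1%g _ mA) image_mulgl invgK. Qed.

Lemma right_invariant_preimage (muR : right_invariant mu) g (A : set (borel G)) :
  measurable A -> mu ((fun x : G => (x * g)%g) @^-1` A) = mu A.
Proof. by move=> mA; rewrite -(muR g^-1%g _ mA) image_mulgr invgK. Qed.

End topological_group.

(** * Adjoints and measurability of matrix coefficients *)

Section unitary_representations.
Context (R : realType) (G : topGroupType) (H : hilbertType R) (pi : unitary_rep G H).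
Implicit Types (g h : G) (v w : H).

Lemma repVK g v : pi g (pi g^-1%g v) = v.
Proof. by rewrite -rep_mul mulgV rep_one. Qed.
Lemma rep_adj g v w : '[pi g v, w] = '[v, pi g^-1%g w].
Proof. by rewrite -{1}(repVK g w) rep_dot. Qed.
Lemma rep_adjV g v w : '[pi g^-1%g v, w] = '[v, pi g w].
Proof. by rewrite rep_adj invgK. Qed.

Lemma measurable_coef v w : Cmeasurable (coef pi v w).
Proof.
have [cre cim] := hdot_continuous w.
split.
- apply: (@continuous_measurable_real _ _ (fun g => Re '[pi g v, w])) => g.
  apply: (@continuous_comp _ _ _ (fun g => pi g v) (fun u => Re '[u, w])); last exact: cre.
  exact: rep_continuous.
- apply: (@continuous_measurable_real _ _ (fun g => Im '[pi g v, w])) => g.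
  apply: (@continuous_comp _ _ _ (fun g => pi g v) (fun u => Im '[u, w])); last exact: cim.
  exact: rep_continuous.
Qed.

End unitary_representations.

(* The two measures are a bi-invariant measure and its image under inversion;
   they are not assumed to be equal. *)
Record inversion_pair (R : realType) (G : topGroupType) := InversionPair {
  pair_measure :> bool -> {measure set (borel G) -> \bar R} ;
  pair_left : forall b, left_invariant (pair_measure b) ;
  pair_right : forall b, right_invariant (pair_measure b) ;
  pair_inv : forall b (A : set (borel G)), measurable A ->
    pair_measure b ((fun x : G => x^-1%g) @^-1` A) = pair_measure (~~ b) A }.

Record L2_family (R : realType) (G : topGroupType) (m : inversion_pair R G)
    (H : hilbertType R) (n : nat) := L2Family {
  family_rep : unitary_rep G H ;
  family_vec : 'I_n -> H ;
  family_L2 : forall b i j, sqint (m b) (coef family_rep (family_vec i) (family_vec j)) }.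

(** * The form of an L^2 family, its regular vectors and weak integrals *)

Section L2_families.
Context (R : realType) (G : topGroupType) (m : inversion_pair R G).
Context (H : hilbertType R) (n : nat) (F : L2_family m H n).
Local Notation pi := (family_rep F).
Local Notation u := (family_vec F).
Implicit Types (b : bool) (v w z : H) (g h : G).

(** The inverse moves the group action onto [v], making [coefs] the matrix coefficients
    [(pi(g) v, u_j)]. *)
Let e (k : bool * 'I_n) (g : borel G) : H := pi (g : G)^-1%g (u k.2).

Let coefsE k v : coefs e k v = coef pi v (u k.2).
Proof. by apply/funext => g; rewrite /coefs /coef rep_adj. Qed.

Let measurable_e k v : Cmeasurable (fun x => '[v, e k x]).
Proof. by have := measurable_coef pi v (u k.2); rewrite -coefsE. Qed.

Definition family_form : closed_form H :=
  coef_form (fun k : bool * 'I_n => m k.1) measurable_e.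

Local Notation D := (fdom family_form).
Local Notation X := (resolvent family_form).
Local Notation C := (cayley family_form).

(** The share of one measure in the form. It is kept apart because the positivity argument needs the
    same measure in the form and in the outer integral. *)
Definition family_form1 b v w : R[i] :=
  \sum_j L2dot (m b) (coef pi v (u j)) (coef pi w (u j)).

Lemma family_formE v w : family_form v w = \sum_b family_form1 b v w.
Proof.
rewrite pair_big /=; apply: eq_bigr => k _.
by rewrite -[L2dot _ _ _]/(L2dot (m k.1) (coefs e k v) (coefs e k w)) !coefsE.
Qed.

Lemma family_domP v : D v <-> forall b j, sqint (m b) (coef pi v (u j)).
Proof.
split => Dv.
- by move=> b j; have := Dv (b, j); rewrite coefsE.
- by move=> k; rewrite coefsE; exact: Dv.
Qed.

Lemma family_dom_vec i : D (u i).
Proof. by apply/family_domP => b j; exact: family_L2. Qed.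

Lemma semidot_family_form1 b : semidot D (family_form1 b).
Proof.
apply: (@semidot_sub _ _ [set v | forall j, sqint (m b) (coef pi v (u j))]).
- exact: (semidot_dom0 (form_semidot family_form)).
- exact: (semidot_domP (form_semidot family_form)).
- by move=> v /family_domP Dv j; exact: Dv.
- apply: (semidot_sum (D := fun j v => sqint (m b) (coef pi v (u j)))
    (B := fun j v w => L2dot (m b) (coef pi v (u j)) (coef pi w (u j)))) => j.
  apply: (semidot_comp (f := fun v => coef pi v (u j)) _ (semidot_L2dot (m b))).
  by move=> a v w; apply/funext => g; rewrite /coef linearP hdotDl hdotZl.
Qed.

Lemma family_form1_le b v : D v -> Re (family_form1 b v v) <= gsq family_form v.
Proof.
move=> Dv; apply: le_trans (form_le_gsq _ _).
rewrite family_formE [leRHS]cRe_sum (bigD1 b)//= lerDl sumr_ge0// => c _.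
exact: (semidot_ge0 (semidot_family_form1 c) Dv).
Qed.

Lemma coef_L2_le_form b j v : D v ->
  Re (L2dot (m b) (coef pi v (u j)) (coef pi v (u j))) <= Re (family_form v v).
Proof.
move=> Dv; rewrite -[u j]/(u (b, j).2) -!coefsE.
exact: (coef_dot_ge (m := fun k : bool * 'I_n => m k.1) (b, j)).
Qed.

Lemma coef_L2_le b j v : D v ->
  Re (L2dot (m b) (coef pi v (u j)) (coef pi v (u j))) <= gsq family_form v.
Proof. by move=> Dv; apply: le_trans (form_le_gsq _ _); exact: coef_L2_le_form. Qed.

Let coef_mulr h v w :
  coef pi (pi h v) w = (coef pi v w : borel G -> _) \o (fun g : G => (g * h)%g).
Proof. by apply/funext => g; rewrite /coef /= rep_mul. Qed.

Let transferR b h := right_invariant_preimage (pair_right m b) h.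

(** The coefficients of [pi h v] are right translates of those of [v], so right invariance
    applies. *)
Lemma family_dom_rep h v : D v -> D (pi h v).
Proof.
move=> /family_domP Dv; apply/family_domP => b j; rewrite coef_mulr.
apply/(sqint_transfer (measurable_mulgr h) (transferR b h)) => //.
exact: measurable_coef.
Qed.

Lemma family_form1_rep b h v w : D v -> D w ->
  family_form1 b (pi h v) (pi h w) = family_form1 b v w.
Proof.
move=> /family_domP Dv /family_domP Dw; apply: eq_bigr => j _; rewrite !coef_mulr.
exact: (L2dot_transfer (measurable_mulgr h) (transferR b h)).
Qed.

Lemma family_form1_repV b h v w : D v -> D w ->
  family_form1 b (pi h^-1%g v) w = family_form1 b v (pi h w).
Proof.
by move=> Dv Dw; rewrite -[in RHS](repVK pi h v) family_form1_rep//; exact: family_dom_rep.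
Qed.

Lemma family_form_rep h v w : D v -> D w ->
  family_form (pi h v) (pi h w) = family_form v w.
Proof.
by move=> Dv Dw; rewrite !family_formE; apply: eq_bigr => b _; exact: family_form1_rep.
Qed.

(** The form is invariant under [pi], so [pi h (X v)] solves the equation that characterizes
    [X (pi h v)]. *)
Lemma resolvent_rep h v : X (pi h v) = pi h (X v).
Proof.
apply/esym/resolvent_unique => [|w Dw]; first exact/family_dom_rep/dom_resolvent.
rewrite -[w](repVK pi h); set w' := pi _ w.
have Dw' : D w' by exact: family_dom_rep.
rewrite /gdot rep_dot family_form_rep ?rep_dot -/(gdot _ _ _) ?gdot_resolvent//.
exact: dom_resolvent.
Qed.

Lemma cayley_rep h v : C (pi h v) = pi h (C v).
Proof. by rewrite /cayley resolvent_rep [RHS]linearB [pi h (2 *: _)]linearZ. Qed.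

Lemma iter_cayley_rep k h v : iter k C (pi h v) = pi h (iter k C v).
Proof. by elim: k => //= k ->; rewrite cayley_rep. Qed.

(** The domain controls coefficients against the vectors [u_j]; regularity controls those of [z]
    against every [w] of the domain, with a bound by the graph norm of [w]. This is what a weak
    integral of [f(g) pi(g) z] needs for square integrable [f]. *)
Definition regular z := D z /\ exists2 c : R, 0 <= c & forall b w, D w ->
  sqint (m b) (coef pi z w) /\
  Re (L2dot (m b) (coef pi z w) (coef pi z w)) <= c * gsq family_form w.

Let coef_inv v w :
  coef pi v w = (fun g => Num.conj (coef pi w v g)) \o (fun g : G => g^-1%g).
Proof. by apply/funext => g; rewrite /coef /= -hdotC rep_adj. Qed.

(** Conjugation and [g |-> g^-1] turn [(pi(g) u_i, w)] into [(pi(g) w, u_i)] while exchanging the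
    two measures; both are controlled by the form. *)
Lemma regular_vec i : regular (u i).
Proof.
split; first exact: family_dom_vec.
exists 1 => // b w Dw.
have S : sqint (m (~~ b)) (fun g => Num.conj (coef pi w (u i) g)).
  by apply: sqintJ; move/family_domP : Dw; exact.
have mI := @measurable_invg G; have tI := pair_inv m b.
rewrite coef_inv mul1r; split.
  by apply/(sqint_transfer mI tI) => //; exact: S.1.
rewrite (L2dot_transfer mI tI)// Re_L2dot.
under eq_Rintegral do rewrite csqJ.
by rewrite -Re_L2dot; exact: coef_L2_le.
Qed.

Lemma regularP a z z' : regular z -> regular z' -> regular (a *: z + z').
Proof.
have LP b := semidot_L2dot (m b); have gP := semidot_gdot family_form.
move=> [Dz [c c0 zc]] [Dz' [c' c'0 zc']].
split; first exact: (semidot_domP gP).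
exists (2 * (csq a * c) + 2 * c'); first by rewrite addr_ge0 ?mulr_ge0 ?csq_ge0.
move=> b w Dw; have [S Sc] := zc b w Dw; have [S' Sc'] := zc' b w Dw.
have -> : coef pi (a *: z + z') w = a *: coef pi z w + coef pi z' w.
  by apply/funext => g; rewrite /coef linearP hdotDl hdotZl.
split; first exact: (semidot_domP (LP b)).
have aS : sqint (m b) (a *: coef pi z w) by exact: (domZ (LP b)).
apply: (le_trans (ReB_sqrD_le (LP b) aS S')).
rewrite (semidotZl (LP b))// (semidotZr (LP b))// [a * _]mulrA.
rewrite (_ : a * Num.conj a = (csq a)%:C%C); last first.
  by apply: complex_eqP; rewrite !ReImE /= /csq; ring.
have -> B : Re ((csq a)%:C%C * B) = csq a * Re B by rewrite cReM /= mul0r subr0.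
have := ler_wpM2l (csq_ge0 a) Sc; lra.
Qed.

Lemma regularZ a z : regular z -> regular (a *: z).
Proof.
(* Writes [a z] as [(a - 1) z + z]. *)
move=> rz; have := regularP (a - 1) rz rz; rewrite scalerBl scale1r.
by rewrite addrNK.
Qed.

Lemma regularB z z' : regular z -> regular z' -> regular (z - z').
Proof. by move=> rz rz'; rewrite addrC -scaleN1r; exact: regularP. Qed.

(** [C] is self-adjoint and commutes with [pi], so it moves onto [w], where it contracts the graph
    norm; the constant is unchanged. *)
Lemma regular_cayley z : regular z -> regular (C z).
Proof.
move=> [Dz [c c0 zc]]; split; first exact: dom_cayley.
exists c => // b w Dw; have [S Sc] := zc b (C w) (dom_cayley Dw).
have -> : coef pi (C z) w = coef pi z (C w).
  by apply/funext => g; rewrite /coef -cayley_rep hdot_cayley.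
by split => //; apply: (le_trans Sc); apply: ler_wpM2l => //; exact: gsq_cayley_le.
Qed.

Lemma regular_iter_cayley k z : regular z -> regular (iter k C z).
Proof. by move=> rz; elim: k => //= k; exact: regular_cayley. Qed.

Lemma regular_resolvent z : regular z -> regular (X z).
Proof.
move=> rz; have -> : X z = 2^-1 *: (z - C z).
  by rewrite /cayley subKr scalerA mulVf ?scale1r// pnatr_eq0.
by apply: regularZ; apply: regularB => //; exact: regular_cayley.
Qed.

(** Since [C^2p - C^(2p+2) = 4 X (1 - X) C^2p], the operator [1 - C^2p] is [X] times a polynomial in
    [X] and [C], which preserves regularity. The extra factor [X] is consumed by
    [weak_integral_hdot]. *)
Lemma one_sub_iter_cayley_regular p z : regular z ->
  exists2 z', regular z' & z - iter p.*2 C z = X z'.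
Proof.
move=> rz; elim: p => [|p [z' rz' E]].
  exists (z - z); first exact: regularB.
  by rewrite /= subrr resolvent0.
exists (4 *: (iter p.*2 C (z - X z)) + z').
  apply: regularP => //; apply: regular_iter_cayley; apply: regularB => //.
  exact: regular_resolvent.
rewrite resolventP -E -iter_cayley_resolvent resolventB -iter_cayleyZ.
rewrite -cayley_cayley iter_cayleyB doubleS !iterSr.
by rewrite [RHS]addrC addrA addrNK.
Qed.

(** Formally [xi] is the sum of the integrals of [f_i(g) pi(g) (X z_i)]. Cauchy-Schwarz in L^2 and
    regularity make each right-hand integral a bounded functional of [w] for the graph norm, so
    [riesz] applies. *)
Lemma weak_integral b (I : finType) (f : I -> borel G -> R[i]) (z : I -> H) :
  (forall i, sqint (m b) (f i)) -> (forall i, regular (z i)) ->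
  exists2 xi, D xi & forall w, D w ->
    gdot family_form xi w = \sum_i Cintegral (m b) (fun g => f i g * coef pi (z i) w g).
Proof.
move=> Sf rz; have gP := semidot_gdot family_form.
have one i : exists xi, D xi /\ forall w, D w ->
    gdot family_form xi w = Cintegral (m b) (fun g => f i g * coef pi (z i) w g).
  have [Dz [c c0 zc]] := rz i.
  have int w : D w -> Cintegrable (m b) (fun g => f i g * coef pi (z i) w g).
    by move=> Dw; apply: sqint_prod => //; have [] := zc b w Dw.
  have f0 : 0 <= Re (L2dot (m b) (f i) (f i)) by exact: (semidot_ge0 (semidot_L2dot (m b))).
  have [||w Dw|xi Dxi xiP] := @riesz _ _ family_form
      (fun w => Cintegral (m b) (fun g => f i g * coef pi (z i) w g))
      (Re (L2dot (m b) (f i) (f i)) * c); last by exists xi.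
  - by rewrite mulr_ge0.
  - move=> a v w Dv Dw; rewrite -(CintegralZ _ (int v Dv)).
    rewrite -(CintegralD (CintegrableZ _ (int v Dv)) (int w Dw)).
    congr Cintegral; apply/funext => g; rewrite /coef hdotDr hdotZr; ring.
  - have [S Sc] := zc b w Dw.
    have := semidot_cauchy_Re (semidot_L2dot (m b)) (Sf i) (sqintJ S).
    rewrite {1}/L2dot; under eq_fun do rewrite conjCK.
    move/le_trans; apply; rewrite -mulrA; apply: ler_wpM2l => //.
    rewrite Re_L2dot; under eq_Rintegral do rewrite csqJ.
    by rewrite -Re_L2dot.
have /choice[xi xiP] := one.
have sumD (r : seq I) : D (\sum_(i <- r) xi i) /\ forall w, D w ->
    gdot family_form (\sum_(i <- r) xi i) w = \sum_(i <- r) gdot family_form (xi i) w.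
  elim: r => [|i r [Dr IH]].
    rewrite big_nil; split; first exact: (semidot_dom0 gP).
    by move=> w Dw; rewrite big_nil (semidot0l gP).
  rewrite big_cons; split; first by apply: (domD gP) => //; exact: (xiP i).1.
  by move=> w Dw; rewrite big_cons (semidotDl gP) ?IH//; exact: (xiP i).1.
exists (\sum_i xi i); first exact: (sumD _).1.
move=> w Dw; rewrite (sumD _).2//; apply: eq_bigr => i _; exact: (xiP i).2.
Qed.

(** Testing against [X w] turns the graph inner product into that of [H]; then [X] is moved onto
    [z i], as it commutes with [pi]. *)
Lemma weak_integral_hdot b (I : finType) (f : I -> borel G -> R[i]) (z : I -> H) xi w :
  (forall w, D w -> gdot family_form xi w =
    \sum_i Cintegral (m b) (fun g => f i g * coef pi (z i) w g)) ->
  D xi -> D w ->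
  '[xi, w] = \sum_i Cintegral (m b) (fun g => f i g * coef pi (X (z i)) w g).
Proof.
move=> xiP Dxi Dw; rewrite -(gdot_resolventr w Dxi) xiP; last exact: dom_resolvent.
apply: eq_bigr => i _; congr Cintegral; apply/funext => g; congr (_ * _).
by rewrite /coef -resolvent_rep hdot_resolvent.
Qed.

End L2_families.

(** * Positivity *)

Section positivity.
Context (R : realType) (G : topGroupType) (m : inversion_pair R G).
Context (H1 H2 : hilbertType R) (n : nat).
Context (F1 : L2_family m H1 n) (F2 : L2_family m H2 n).
Local Notation pi1 := (family_rep F1).
Local Notation pi2 := (family_rep F2).
Local Notation D1 := (fdom (family_form F1)).
Local Notation D2 := (fdom (family_form F2)).
Local Notation X1 := (resolvent (family_form F1)).
Local Notation X2 := (resolvent (family_form F2)).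
Context (v : 'I_n -> H1) (z : 'I_n -> H2).
Hypothesis (v_reg : forall i, regular F1 (v i)) (z_reg : forall i, regular F2 (z i)).

Let r i := X1 (v i).
Let y i := X2 (z i).
Let c i j : borel G -> R[i] := coef pi2 (y i) (y j).

Let Dr i : D1 (r i). Proof. exact: dom_resolvent. Qed.
Let Dy i : D2 (y i). Proof. exact: dom_resolvent. Qed.

Let c_L2 b i j : sqint (m b) (c i j).
Proof. by have [_ [k _ /(_ b _ (Dy j))[]]] := regular_resolvent (z_reg i). Qed.

(** The form of a single measure is bounded for the graph norm built from both, hence represented by
    a vector. *)
Let form1_riesz b s : D1 s ->
  exists2 t, D1 t & forall w, D1 w -> family_form1 F1 b w s = gdot (family_form F1) w t.
Proof.
move=> Ds; have bP := semidot_family_form1 F1 b.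
have [|a w w' Dw Dw'|w Dw|t Dt tP] := @riesz _ _ (family_form F1) (family_form1 F1 b s)
    (Re (family_form1 F1 b s s)); first exact: (semidot_ge0 bP).
- by rewrite (semidotDr bP)// ?(semidotZr bP)//; exact: (domZ bP).
- apply: (le_trans (semidot_cauchy_Re bP Ds Dw)); apply: ler_wpM2l.
    exact: (semidot_ge0 bP).
  exact: family_form1_le.
exists t => // w Dw; rewrite (semidotC bP)// (semidotC (semidot_gdot _))//.
by rewrite tP.
Qed.

(** Because [r i = X1 (v i)], the form along an orbit is an ordinary coefficient of the regular
    vector [v i], hence square integrable. *)
Let form1_coef b s : D1 s -> exists2 t, D1 t &
  forall i g, family_form1 F1 b (pi1 g (r i)) s = coef pi1 (v i) t g.
Proof.
move=> Ds; have [t Dt tP] := form1_riesz b Ds; exists t => // i g.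
rewrite tP; last exact/family_dom_rep.
by rewrite /r -resolvent_rep gdot_resolvent.
Qed.

Let integrable_c b i j w : D1 w -> Cintegrable (m b) (fun g => c i j g * coef pi1 (v i) w g).
Proof.
by move=> Dw; apply: sqint_prod => //; have [_ [k _ /(_ b _ Dw)[]]] := v_reg i.
Qed.

(** Here [b] selects the measure of the outer integral and [b'] the one inside the form. *)
Let S b b' := \sum_i \sum_j
  Cintegral (m b) (fun g => c i j g * family_form1 F1 b' (pi1 g (r i)) (r j)).

Lemma integrable_form1 b b' i j :
  Cintegrable (m b) (fun g => c i j g * family_form1 F1 b' (pi1 g (r i)) (r j)).
Proof.
have [t Dt tP] := form1_coef b' (Dr j).
by under eq_fun do rewrite tP; exact: integrable_c.
Qed.

Let eta_exists b j : exists2 eta, D1 eta & forall w, D1 w ->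
  gdot (family_form F1) eta w = \sum_i Cintegral (m b) (fun g => c i j g * coef pi1 (v i) w g).
Proof. exact: (weak_integral (f := fun i => c i j)). Qed.

(** The exchange of integrals: after [form1_riesz] the form is a graph pairing with a fixed vector
    [t], and the outer integral of such pairings defines [eta j]. *)
Let S_eta b b' (eta : 'I_n -> H1) :
  (forall j, D1 (eta j) /\ forall w, D1 w -> gdot (family_form F1) (eta j) w =
     \sum_i Cintegral (m b) (fun g => c i j g * coef pi1 (v i) w g)) ->
  S b b' = \sum_j family_form1 F1 b' (eta j) (r j).
Proof.
move=> etaP; rewrite /S exchange_big /=; apply: eq_bigr => j _.
have [Deta etaE] := etaP j.
have [t Dt tP] := form1_riesz b' (Dr j).
rewrite tP// etaE//; apply: eq_bigr => i _; congr Cintegral; apply/funext => g.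
rewrite tP; last exact/family_dom_rep.
by rewrite /r -resolvent_rep gdot_resolvent.
Qed.

(* Moving the outer integral inside the inner product, the sum becomes
   [\sum_l '[xi_l, xi_l]], where
   [xi_l = \sum_i \int '[pi1 g (r i), u_l] pi2 g (y i) dg]. *)
Let S_ge0 b : 0 <= S b b.
Proof.
have /choice[eta etaP] j : exists eta, D1 eta /\ forall w, D1 w ->
    gdot (family_form F1) eta w = \sum_i Cintegral (m b) (fun g => c i j g * coef pi1 (v i) w g).
  by have [eta ? ?] := eta_exists b j; exists eta.
rewrite (S_eta b etaP) /family_form1 exchange_big /=; apply: sumr_ge0 => l _.
pose f i : borel G -> R[i] := coef pi1 (r i) (family_vec F1 l).
have f_L2 i : sqint (m b) (f i) by move/family_domP : (Dr i); exact.
have [xi Dxi xiP] := weak_integral f_L2 z_reg.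
have xiE w : D2 w -> '[xi, w] = \sum_i Cintegral (m b) (fun g => f i g * coef pi2 (y i) w g).
  by move=> Dw; rewrite (weak_integral_hdot xiP).
(* Substituting [x^-1 g] for [g] moves [x] off the coefficient of [pi1], leaving [f i g], and onto
   [y j] in the coefficient of [pi2]. Left invariance is used here. *)
have etaE j x : coef pi1 (eta j) (family_vec F1 l) x = '[xi, pi2 x (y j)].
  rewrite xiE; last exact/family_dom_rep.
  rewrite /coef rep_adj (weak_integral_hdot (etaP j).2 (etaP j).1); last first.
    exact/family_dom_rep/family_dom_vec.
  apply: eq_bigr => i _.
  have tL := left_invariant_preimage (pair_left m b) x^-1%g.
  have mf : Cmeasurable (fun g => c i j g * coef pi1 (r i) (pi1 x^-1%g (family_vec F1 l)) g).
    by apply: CmeasurableM; exact: measurable_coef.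
  rewrite -(Cintegral_transfer (measurable_mulgl x^-1%g) tL mf); last first.
    apply: sqint_prod => //.
    have [_ [k _ h]] := regular_resolvent (v_reg i).
    by have [] := h b _ (family_dom_rep x^-1%g (family_dom_vec F1 l)).
  congr Cintegral; apply/funext => g; rewrite /= mulrC; congr (_ * _).
    by rewrite /f /coef rep_mul rep_dot.
  by rewrite /c /coef rep_mul rep_adjV.
(* Up to conjugation, this is the integral formula for [(xi, w)] at [w = xi]. *)
have -> : \sum_j L2dot (m b) (coef pi1 (eta j) (family_vec F1 l))
    (coef pi1 (r j) (family_vec F1 l)) = Num.conj '[xi, xi].
  rewrite xiE// rmorph_sum /=; apply: eq_bigr => j _; rewrite -CintegralJ; last first.
    apply: sqint_prod => //.
    by have [_ [k _ /(_ b _ Dxi)[]]] := regular_resolvent (z_reg j).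
  congr Cintegral; apply/funext => x; rewrite etaE rmorphM mulrC /=; congr (_ * _).
  by rewrite /coef -hdotC.
by rewrite -hdotC hdot_hsq ler0c hsq_ge0.
Qed.

(** The substitution [g |-> g^-1] exchanges the outer measure and conjugates both factors, up to
    exchanging [i] and [j]. *)
Let S_inv b : S b (~~ b) = Num.conj (S (~~ b) (~~ b)).
Proof.
rewrite /S exchange_big /= rmorph_sum /=; apply: eq_bigr => i _.
rewrite rmorph_sum /=; apply: eq_bigr => j _.
have mI := @measurable_invg G; have tI := pair_inv m (~~ b).
have mE (A : set (borel G)) : measurable A -> m (~~ b) ((fun x : G => x^-1%g) @^-1` A) = m b A.
  by move=> mA; rewrite tI// negbK.
have I1 := integrable_form1 b (~~ b) j i.
have mc : Cmeasurable (fun g => c j i g * family_form1 F1 (~~ b) (pi1 g (r j)) (r i)).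
  have [t Dt tP] := form1_coef (~~ b) (Dr i).
  by under eq_fun do rewrite tP; apply: CmeasurableM; exact: measurable_coef.
rewrite -(Cintegral_transfer mI mE mc I1) -CintegralJ; last exact: integrable_form1.
have bP := semidot_family_form1 F1 (~~ b).
congr Cintegral; apply/funext => g; rewrite /= rmorphM /=; congr (_ * _).
  by rewrite /c /coef -hdotC rep_adjV.
by rewrite family_form1_repV// -(semidotC bP)//; exact: family_dom_rep.
Qed.

(** The full form is the sum over both measures. The matching one gives [S b b], and [S_inv] reduces
    the mixed term to a matching one. *)
Lemma sum_integral_form_ge0 b : 0 <= \sum_i \sum_j
  Cintegral (m b) (fun g => coef pi2 (X2 (z i)) (X2 (z j)) g *
                            family_form F1 (pi1 g (X1 (v i))) (X1 (v j))).
Proof.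
suff -> : \sum_i \sum_j Cintegral (m b) (fun g => coef pi2 (X2 (z i)) (X2 (z j)) g *
    family_form F1 (pi1 g (X1 (v i))) (X1 (v j))) = S b b + Num.conj (S (~~ b) (~~ b)).
  by rewrite addr_ge0 ?S_ge0// conj_conjc conj_ge0 S_ge0.
rewrite -S_inv /S -big_split /=; apply: eq_bigr => i _; rewrite -big_split /=.
apply: eq_bigr => j _; rewrite -CintegralD; try exact: integrable_form1.
congr Cintegral; apply/funext => g; rewrite -mulrDr; congr (_ * _).
rewrite -[LHS]/(form_val (family_form F1) _ _) family_formE.
by rewrite big_bool; case: (b); rewrite //= addrC.
Qed.

Lemma integrable_form b i j :
  Cintegrable (m b) (fun g => coef pi2 (X2 (z i)) (X2 (z j)) g *
                              family_form F1 (pi1 g (X1 (v i))) (X1 (v j))).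
Proof.
under eq_fun do rewrite family_formE mulr_sumr.
by apply: Cintegrable_sum => b' _; exact: integrable_form1.
Qed.

End positivity.

(** * Approximation: truncating the telescoping sum and removing the regularization *)

Lemma csq_sum_integral_le d (T : measurableType d) (R : realType)
    (mu : {measure set T -> \bar R}) (K : finType) (f g : K -> T -> R[i]) :
  (forall k, sqint mu (f k)) -> (forall k, sqint mu (g k)) ->
  csq (\sum_k Cintegral mu (fun x => f k x * g k x)) <=
  2 * ((\sum_k Re (L2dot mu (f k) (f k))) * (\sum_k Re (L2dot mu (g k) (g k)))).
Proof.
move=> Sf Sg.
(* Cauchy-Schwarz is applied once, in the direct sum of [K] copies of L^2. *)
have BP : semidot [set h : K -> T -> R[i] | forall k, sqint mu (h k)]
    (fun h h' => \sum_k L2dot mu (h k) (h' k)).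
  apply: (semidot_sum (D := fun k (h : K -> T -> R[i]) => sqint mu (h k))
    (B := fun k (h h' : K -> T -> R[i]) => L2dot mu (h k) (h' k))) => k.
  exact: (semidot_comp (f := fun h : K -> T -> R[i] => h k) _ (semidot_L2dot mu)).
have Sg' k : sqint mu (fun x => Num.conj (g k x)) by exact: sqintJ.
have := semidot_cauchy BP Sf Sg'; rewrite !cRe_sum.
have -> : \sum_k L2dot mu (f k) (fun x => Num.conj (g k x)) =
    \sum_k Cintegral mu (fun x => f k x * g k x).
  by apply: eq_bigr => k _; congr Cintegral; apply/funext => x; rewrite conjCK.
congr (_ <= _ * (_ * _)); apply: eq_bigr => k _.
by rewrite !Re_L2dot; apply: eq_Rintegral => x _; rewrite csqJ.
Qed.

Lemma complex_ge0_approx (R : realType) (x : R[i]) :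
  (forall e : R, 0 < e -> exists2 y, 0 <= y & csq (x - y) < e) -> 0 <= x.
Proof.
move=> h; rewrite complex_ge0; apply/andP; split.
- rewrite -sqrf_eq0; apply/eqP; apply: (@eq0_small _ _ 1) => //; first exact: sqr_ge0.
  move=> e /h[y]; rewrite complex_ge0 => /andP[/eqP y0 _].
  by rewrite /csq cReD cImD cReN cImN y0; have := sqr_ge0 (Re x - Re y); nra.
- rewrite leNgt; apply/negP => x0.
  have [|y] := h (Re x ^+ 2); first by nra.
  rewrite complex_ge0 => /andP[_ y0].
  by rewrite /csq cReD cImD cReN cImN; have := sqr_ge0 (Im x - Im y); nra.
Qed.

Lemma form_iter_cayley_cvg_uniform (R : realType) (H : hilbertType R) (q : closed_form H)
    (K : finType) (v : K -> H) (e : R) : (forall k, fdom q (v k)) -> 0 < e ->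
  exists N, forall p, (N <= p)%N -> forall k,
    Re (q (iter p.*2 (cayley q) (v k)) (iter p.*2 (cayley q) (v k))) < e.
Proof.
move=> Dv e0.
have /choice[N NP] k := form_iter_cayley_cvg (Dv k) e0.
exists (\max_k N k)%N => p Np k; apply: NP; apply: leq_trans Np; exact: leq_bigmax.
Qed.

Section positivity_limit.
Context (R : realType) (G : topGroupType) (m : inversion_pair R G).
Context (H1 H2 : hilbertType R) (n : nat).
Context (F1 : L2_family m H1 n) (F2 : L2_family m H2 n).
Local Notation pi1 := (family_rep F1).
Local Notation pi2 := (family_rep F2).
Local Notation u1 := (family_vec F1).
Local Notation u2 := (family_vec F2).
Local Notation X1 := (resolvent (family_form F1)).
Local Notation C1 := (cayley (family_form F1)).
Local Notation C2 := (cayley (family_form F2)).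

Lemma sum_coef_L2_small (H : hilbertType R) (F : L2_family m H n) b (w : 'I_n -> H) (e : R) :
  (forall i, fdom (family_form F) (w i)) ->
  (forall i, Re (family_form F (w i) (w i)) <= e) ->
  \sum_(k : 'I_n * 'I_n) Re (L2dot (m b) (coef (family_rep F) (w k.1) (family_vec F k.2))
    (coef (family_rep F) (w k.1) (family_vec F k.2))) <= #|{: 'I_n * 'I_n}|%:R * e.
Proof.
move=> Dw we; rewrite mulr_natl -sumr_const; apply: ler_sum => k _.
by apply: le_trans (we k.1); exact: coef_L2_le_form.
Qed.

Lemma small_bound (a c e : R) : 0 <= a -> 0 <= c -> 0 < e ->
  exists2 e', 0 < e' & 2 * (a * (c * e')) < e.
Proof.
move=> a0 c0 e0; have ac : 0 <= a * c by exact: mulr_ge0.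
have ac0 : 0 < 2 * (a * c) + 1 by lra.
exists (e / (2 * (a * c) + 1)); first exact: divr_gt0.
rewrite (_ : 2 * _ = (2 * (a * c)) * e / (2 * (a * c) + 1)); last by field; rewrite gt_eqF.
by rewrite ltr_pdivrMr//; nra.
Qed.

(** With the vectors of [pi2] regularized, [hdot_telescope] expands the coefficients of [pi1]. Each
    term of the expansion contributes a nonnegative amount by [sum_integral_form_ge0] at
    [v_i = C1^j u1_i]; Cauchy-Schwarz makes the remainder small. *)
Lemma sum_integral_regularized_ge0 b p : 0 <= \sum_(k : 'I_n * 'I_n)
  Cintegral (m b) (fun g =>
    coef pi2 (u2 k.1 - iter p.*2 C2 (u2 k.1)) (u2 k.2 - iter p.*2 C2 (u2 k.2)) g *
    coef pi1 (u1 k.1) (u1 k.2) g).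
Proof.
have /choice[z zP] i : exists z, regular F2 z /\
    u2 i - iter p.*2 C2 (u2 i) = resolvent (family_form F2) z.
  by have [z ? ?] := one_sub_iter_cayley_regular p (regular_vec F2 i); exists z.
have zR i : regular F2 (z i) := (zP i).1.
pose c (k : 'I_n * 'I_n) : borel G -> R[i] :=
  coef pi2 (resolvent (family_form F2) (z k.1)) (resolvent (family_form F2) (z k.2)).
under eq_bigr => k _ do rewrite !(zP _).2 -/(c k).
have c_L2 k : sqint (m b) (c k).
  have [_ [a _ h]] := regular_resolvent (zR k.1).
  by have [] := h b _ (dom_resolvent _ (z k.2)).
have C_L2 w (Dw : forall i, fdom (family_form F1) (w i)) (k : 'I_n * 'I_n) :
    sqint (m b) (coef pi1 (w k.1) (u1 k.2)).
  by move/family_domP : (Dw k.1); exact.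
have Du1 i : fdom (family_form F1) (u1 i) := family_dom_vec F1 i.
apply: complex_ge0_approx => e e0.
pose A := \sum_k Re (L2dot (m b) (c k) (c k)).
have A0 : 0 <= A by apply: sumr_ge0 => k _; exact: (semidot_ge0 (semidot_L2dot (m b))).
(* [A] involves only the regularized coefficients of [pi2], so [e'], and then [M], can be chosen
   after it. *)
have [e' e'0 e'e] := small_bound A0 (ler0n _ #|{: 'I_n * 'I_n}|) e0.
have [M MP] := form_iter_cayley_cvg_uniform Du1 e'0.
have DM i : fdom (family_form F1) (iter M.*2 C1 (u1 i)) by exact: dom_iter_cayley.
pose t j (k : 'I_n * 'I_n) : borel G -> R[i] := fun g =>
  c k g * family_form F1 (pi1 g (X1 (iter j C1 (u1 k.1)))) (X1 (iter j C1 (u1 k.2))).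
have vR j i : regular F1 (iter j C1 (u1 i)) by apply: regular_iter_cayley; exact: regular_vec.
have It j k : Cintegrable (m b) (t j k) by exact: (integrable_form (vR j) zR).
exists (4 * \sum_(j < M) \sum_k Cintegral (m b) (t j k)).
  rewrite mulr_ge0// sumr_ge0// => j _.
  have := sum_integral_form_ge0 (vR j) zR b.
  by rewrite pair_big.
set y := 4 * _.
have -> : \sum_k Cintegral (m b) (fun g => c k g * coef pi1 (u1 k.1) (u1 k.2) g) - y =
    \sum_k Cintegral (m b) (fun g => c k g * coef pi1 (iter M.*2 C1 (u1 k.1)) (u1 k.2) g).
  rewrite /y exchange_big mulr_sumr -sumrB; apply: eq_bigr => k _.
  apply/eqP; rewrite subr_eq; apply/eqP.
  rewrite -(Cintegral_sum _ (fun (j : 'I_M) _ => It j k)) -CintegralZ; last first.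
    by apply: Cintegrable_sum => j _; exact: It.
  rewrite -CintegralD; first last.
  - by apply: CintegrableZ; apply: Cintegrable_sum => j _; exact: It.
  - by apply: sqint_prod => //; exact: (C_L2 _ DM k).
  congr Cintegral; apply/funext => g.
  rewrite {1}/coef (hdot_telescope (family_form F1) M) mulrDr addrC; congr (_ + _).
    by rewrite iter_cayley_rep.
  rewrite mulrCA mulr_sumr; congr (_ * _); apply: eq_bigr => j _.
  by rewrite iter_cayley_rep resolvent_rep.
apply: le_lt_trans e'e; apply: (le_trans (csq_sum_integral_le c_L2 (C_L2 _ DM))).
rewrite ler_wpM2l// ler_wpM2l//.
apply: (sum_coef_L2_small b (w := fun i => iter M.*2 C1 (u1 i))) => // i.
by apply: ltW; exact: MP.
Qed.

(** Second limit: the regularization [1 - C2^2N] tends to the identity, the error being controlled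
    by the form at [C2^2N u2] and [C2^4N u2]. *)
Lemma sum_integral_coef_ge0 b : 0 <= \sum_i \sum_j
  Cintegral (m b) (fun g => coef pi1 (u1 i) (u1 j) g * coef pi2 (u2 i) (u2 j) g).
Proof.
have a_L2 (k : 'I_n * 'I_n) : sqint (m b) (coef pi1 (u1 k.1) (u1 k.2)).
  exact: family_L2.
have gP := form_semidot (family_form F2).
have Du2 i : fdom (family_form F2) (u2 i) := family_dom_vec F2 i.
rewrite pair_big /=; apply: complex_ge0_approx => e e0.
pose A := \sum_(k : 'I_n * 'I_n) Re (L2dot (m b) (coef pi1 (u1 k.1) (u1 k.2))
  (coef pi1 (u1 k.1) (u1 k.2))).
have A0 : 0 <= A by apply: sumr_ge0 => k _; exact: (semidot_ge0 (semidot_L2dot (m b))).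
have [e' e'0 e'e] := small_bound A0 (ler0n _ #|{: 'I_n * 'I_n}|) e0.
(* The form at [w i] is at most [2 * 4 + 2 = 10] times this bound. *)
have [N NP] := form_iter_cayley_cvg_uniform Du2 (divr_gt0 e'0 (ltr0n _ 10)).
pose w i := 2 *: iter N.*2 C2 (u2 i) - iter N.*2.*2 C2 (u2 i).
have DC k i : fdom (family_form F2) (iter k C2 (u2 i)) by exact: dom_iter_cayley.
have Dw i : fdom (family_form F2) (w i) by apply: (domB gP) => //; exact: (domZ gP).
have w_L2 (k : 'I_n * 'I_n) : sqint (m b) (coef pi2 (w k.1) (u2 k.2)).
  by move/family_domP : (Dw k.1); exact.
exists (\sum_(k : 'I_n * 'I_n) Cintegral (m b) (fun g =>
    coef pi2 (u2 k.1 - iter N.*2 C2 (u2 k.1)) (u2 k.2 - iter N.*2 C2 (u2 k.2)) g *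
    coef pi1 (u1 k.1) (u1 k.2) g)).
  exact: sum_integral_regularized_ge0.
rewrite -sumrB.
have E (k : 'I_n * 'I_n) :
    Cintegral (m b) (fun g => coef pi1 (u1 k.1) (u1 k.2) g * coef pi2 (u2 k.1) (u2 k.2) g) -
    Cintegral (m b) (fun g =>
      coef pi2 (u2 k.1 - iter N.*2 C2 (u2 k.1)) (u2 k.2 - iter N.*2 C2 (u2 k.2)) g *
      coef pi1 (u1 k.1) (u1 k.2) g) =
    Cintegral (m b) (fun g => coef pi1 (u1 k.1) (u1 k.2) g * coef pi2 (w k.1) (u2 k.2) g).
  (* Moving the second factor [1 - C2^2N] to the left gives [(1 - C2^2N)^2 u2 = u2 - w]. *)
  have cE g : coef pi2 (u2 k.1 - iter N.*2 C2 (u2 k.1)) (u2 k.2 - iter N.*2 C2 (u2 k.2)) g =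
      coef pi2 (u2 k.1 - w k.1) (u2 k.2) g.
    rewrite /coef hdotBr -hdot_iter_cayley iter_cayley_rep -hdotBl -linearB.
    congr '[pi2 g _, _]; rewrite iter_cayleyB -iterD addnn /w.
    move: (iter _ _ _) (iter _ _ _) => x x'; rewrite !opprB scaler_nat mulr2n.
    by rewrite opprD -addrA [- x' + _]addrCA.
  have y_L2 : sqint (m b) (coef pi2 (u2 k.1 - w k.1) (u2 k.2)).
    by have /family_domP := domB gP (Du2 k.1) (Dw k.1); exact.
  apply/eqP; rewrite subr_eq; apply/eqP; rewrite -CintegralD; first last.
  - by under eq_fun do rewrite cE; exact: sqint_prod.
  - exact: sqint_prod.
  congr Cintegral; apply/funext => g; rewrite cE /coef.
  by rewrite [pi2 g (_ - w _)]linearB hdotBl; ring.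
rewrite (eq_bigr _ (fun k _ => E k)).
apply: le_lt_trans e'e; apply: (le_trans (csq_sum_integral_le a_L2 w_L2)).
rewrite ler_wpM2l// ler_wpM2l//; apply: (sum_coef_L2_small b (w := w)) => // i.
have DZ : fdom (family_form F2) (2 *: iter N.*2 C2 (u2 i)) by exact: (domZ gP).
apply: (le_trans (ReB_sqrD_le gP DZ (domN gP (DC _ i)))).
rewrite (semidotNl gP)// ?(semidotNr gP)//; last exact: (domN gP).
rewrite (semidotZl gP)// ?(semidotZr gP)// conjC_nat.
rewrite !cReM !cImM !cRe_nat !cIm_nat !mul0r !subr0 opprK.
have := NP N (leqnn _) i; have := NP N.*2 ltac:(lia) i; lra.
Qed.

End positivity_limit.

(** * A bi-invariant measure paired with its image under inversion *)

Lemma inversion_image_exists (R : realType) (G : topGroupType)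
    (mu : {measure set (borel G) -> \bar R}) :
  exists nu : {measure set (borel G) -> \bar R},
    forall A, measurable A -> nu A = mu ((fun x : G => x^-1%g) @^-1` A).
Proof.
unshelve eexists (pushforward mu ((fun x : G => x^-1%g) : borel G -> borel G)) => //.
exact: measurable_invg.
Qed.

Section inversion.
Context (R : realType) (G : topGroupType) (mu nu : {measure set (borel G) -> \bar R}).
Hypothesis (muL : left_invariant mu) (muR : right_invariant mu).
Hypothesis nuE : forall A : set (borel G), measurable A ->
  nu A = mu ((fun x : G => x^-1%g) @^-1` A).

Let haar_pair_measure (b : bool) := if b then mu else nu.

Let measurable_invg_preimage (A : set (borel G)) :
  measurable A -> measurable ((fun x : G => x^-1%g) @^-1` A : set (borel G)).
Proof. by move=> mA; rewrite -[X in measurable X]setTI; exact: (@measurable_invg G). Qed.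

(** Inversion exchanges left and right translations, so left invariance of [nu] comes from right
    invariance of [mu]. *)
Lemma haar_pair_left b : left_invariant (haar_pair_measure b).
Proof.
case: b => //= g A mA; rewrite image_mulgl.
have mgA : measurable ((fun x : G => (g^-1 * x)%g) @^-1` A : set (borel G)).
  by rewrite -[X in measurable X]setTI; exact: (@measurable_mulgl G).
rewrite !nuE// -(right_invariant_preimage muR g (measurable_invg_preimage mA)).
by congr (mu _); apply/funext => x; rewrite /preimage /= invgM.
Qed.

Lemma haar_pair_right b : right_invariant (haar_pair_measure b).
Proof.
case: b => //= g A mA; rewrite image_mulgr.
have mgA : measurable ((fun x : G => (x * g^-1)%g) @^-1` A : set (borel G)).
  by rewrite -[X in measurable X]setTI; exact: (@measurable_mulgr G).
rewrite !nuE// -(left_invariant_preimage muL g (measurable_invg_preimage mA)).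
by congr (mu _); apply/funext => x; rewrite /preimage /= invgM.
Qed.

Lemma haar_pair_inv b (A : set (borel G)) : measurable A ->
  haar_pair_measure b ((fun x : G => x^-1%g) @^-1` A) = haar_pair_measure (~~ b) A.
Proof.
move=> mA; case: b => /=; first by rewrite nuE.
rewrite nuE; last exact: measurable_invg_preimage.
congr (mu _).
by apply/seteqP; split => x; rewrite /preimage /= invgK.
Qed.

Definition haar_pair : inversion_pair R G :=
  InversionPair haar_pair_left haar_pair_right haar_pair_inv.

(** For [nu], the coefficient of [(u i, u j)] becomes after inversion the conjugate of that of
    [(u j, u i)]; the hypothesis covers all ordered pairs. *)
Lemma haar_pair_L2 (H : hilbertType R) (pi : unitary_rep G H) (n : nat) (u : 'I_n -> H) :
  (forall i j, CLfun mu 2%:E (coef pi (u i) (u j))) ->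
  forall b i j, sqint (haar_pair b) (coef pi (u i) (u j)).
Proof.
move=> L2u; have S i j : sqint mu (coef pi (u i) (u j)) by apply/CLfun2.
case => // i j.
have muE A (mA : measurable A) := esym (nuE mA).
apply/(sqint_transfer (@measurable_invg G) muE (measurable_coef pi (u i) (u j))).
have -> : coef pi (u i) (u j) \o (fun x : G => x^-1%g) =
    (fun g => Num.conj (coef pi (u j) (u i) g)).
  by apply/funext => g; rewrite /coef /= -hdotC rep_adjV.
exact: sqintJ.
Qed.

End inversion.

(** * Coefficients of the tensor product and the conclusion *)

Lemma coef_tensor_sum (R : realType) (G : topGroupType) (H H1 H2 T : hilbertType R)
    (pi : unitary_rep G H) (pi1 : unitary_rep G H1) (pi2 : unitary_rep G H2)
    (t : hilbert_tensor H1 H2 T) (rho : unitary_rep G T) (n : nat)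
    (u1 : 'I_n -> H1) (u2 : 'I_n -> H2) (phi : unitary_equiv rho pi) :
  is_tensor_rep t pi1 pi2 rho ->
  coef pi (phi (\sum_i t (u1 i) (u2 i))) (phi (\sum_i t (u1 i) (u2 i))) =
  fun g => \sum_i \sum_j coef pi1 (u1 i) (u1 j) g * coef pi2 (u2 i) (u2 j) g.
Proof.
move=> rhoE; apply/funext => g.
rewrite /coef -equiv_rep equiv_dot [rho g _]linear_sum hdot_suml; apply: eq_bigr => i _.
by rewrite hdot_sumr; apply: eq_bigr => j _; rewrite rhoE tens_dot.
Qed.

Theorem theorem7p1 (R : realType) (G : topGroupType)
    (lcG : locally_compact_group G) (unimodG : unimodular R G)
    (mu : {measure set (borel G) -> \bar R}) (haar_mu : haar_measure mu)
    (H H1 H2 : hilbertType R)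
    (pi : unitary_rep G H) (pi1 : unitary_rep G H1) (pi2 : unitary_rep G H2)
    (L2pi1 : Lp_rep mu 2%:E pi1) (L2pi2 : Lp_rep mu 2%:E pi2)
    (T : hilbertType R) (t : hilbert_tensor H1 H2 T)
    (rho : unitary_rep G T) (rhoE : is_tensor_rep t pi1 pi2 rho)
    (phi : unitary_equiv rho pi)
    (n : nat) (u1 : 'I_n -> H1) (u2 : 'I_n -> H2) (u : H)
    (uE : u = phi (\sum_(i < n) t (u1 i) (u2 i)))
    (L2u1 : forall i j, CLfun mu 2%:E (coef pi1 (u1 i) (u1 j)))
    (L2u2 : forall i j, CLfun mu 2%:E (coef pi2 (u2 i) (u2 j))) :
  [/\ Cintegrable mu (coef pi u u),
      (forall i j, Cintegrable mu
         (fun g => coef pi1 (u1 i) (u1 j) g * coef pi2 (u2 i) (u2 j) g)),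
      Cintegral mu (coef pi u u) =
        \sum_(i < n) \sum_(j < n) Cintegral mu
          (fun g => coef pi1 (u1 i) (u1 j) g * coef pi2 (u2 i) (u2 j) g)
    & 0 <= \sum_(i < n) \sum_(j < n) Cintegral mu
          (fun g => coef pi1 (u1 i) (u1 j) g * coef pi2 (u2 i) (u2 j) g)].
Proof.
have [nu nuE] := inversion_image_exists mu.
have [_ muL _] := haar_mu; have muR := unimodG mu haar_mu.
have I12 i j : Cintegrable mu
    (fun g => coef pi1 (u1 i) (u1 j) g * coef pi2 (u2 i) (u2 j) g).
  by apply: sqint_prod; apply/CLfun2.
have I12s i : Cintegrable mu
    (fun g => \sum_j coef pi1 (u1 i) (u1 j) g * coef pi2 (u2 i) (u2 j) g).
  by apply: Cintegrable_sum.
rewrite uE (coef_tensor_sum _ _ _ rhoE); split => //.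
- by apply: Cintegrable_sum.
- by rewrite Cintegral_sum//; apply: eq_bigr => i _; rewrite Cintegral_sum.
pose F1 := L2Family (haar_pair_L2 muL muR nuE L2u1).
pose F2 := L2Family (haar_pair_L2 muL muR nuE L2u2).
(* The index [true] selects [mu] itself in the pair. *)
exact: (sum_integral_coef_ge0 F1 F2 true).
Qed.
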